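(* Let $\nu=\nu(x,y)$ be a solution, on an open set $\mathcal D\subset\mathbb R^2\cong\mathbb C$, of the partial differential equation $$\Delta\ln\nu+2\nu=0,$$ satisfying $$\nu>0,\qquad \nu_x\nu_y\neq0\qquad\text{on }\mathcal D.$$ Then locally, i.e. on a neighborhood of each point of $\mathcal D$, $\nu$ is given by the formula $$\nu(x,y)=\frac{4(u_x^2+u_y^2)}{(u^2+v^2+1)^2},$$ where $w=u(x,y)+iv(x,y)$ is a holomorphic function of $x+iy$ on that neighborhood.
   Context: All functions are real-valued and $C^\infty$ unless stated otherwise; $\Delta=\partial_x^2+\partial_y^2$ is the flat Laplacian, and $\mathbb R^2$ is identified with $\mathbb C$ via $(x,y)\mapsto x+iy$. *)

(* Defs.v *)
From Stdlib Require Import Reals.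
From Coquelicot Require Import Coquelicot.
Open Scope R_scope.

(* The pair (x, y) : C stands for x + iy.  Functions of two real variables are
   total, of type R -> R -> R; only their values on the open set considered
   matter, since all the notions below are local. *)

Definition smooth_on (D : C -> Prop) (f : R -> R -> R) : Prop :=
  forall x y : R, D (x, y) -> forall n : nat, ex_diff_n f n x y.

Definition d_x (f : R -> R -> R) : R -> R -> R := partial_derive 1 0 f.
Definition d_y (f : R -> R -> R) : R -> R -> R := partial_derive 0 1 f.

Definition laplacian (f : R -> R -> R) (x y : R) : R :=
  partial_derive 2 0 f x y + partial_derive 0 2 f x y.

(* [ex_derive] over the field C is complex differentiability. *)
Definition holomorphic_on (U : C -> Prop) (w : C -> C) : Prop :=
  forall z : C, U z -> @ex_derive C_AbsRing C_NormedModule w z.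

(* Main.v *)
Require Import Defs.
From Stdlib Require Import Reals Lra Lia PSeries_reg.
From Coquelicot Require Import Coquelicot.
Open Scope R_scope.

(** Write p = ln nu, so that 4 p_{z zbar} = - 2 exp p, and put
    q = p_zz / 2 - p_z^2 / 4.  Differentiating the equation shows that q is
    holomorphic ([potential_holomorphic]).

    If w = Z / Y is the quotient of two solutions of the complex linear equation
    y'' = - q y, then w' = (Z' Y - Y' Z) / Y^2, and the formula for nu says that
    nu (|Y|^2 + |Z|^2)^2 = 4 |Z' Y - Y' Z|^2.  To choose such Y and Z, attach to a
    solution y the function m = y' + p_z y / 2.  The vectors (m, sqrt nu y / 2)
    solve a linear first-order system which, up to the scalar factor
    exp (p / 2), preserves their Hermitian products: for two solutions y, Y with
    companions m, M, the function h = m conj M + nu y conj Y / 4 satisfies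
    dh = (dp / 2) h ([gram_partials]).  If the vectors of Y and Z are orthogonal
    and of equal length at the given point, then they remain so nearby
    ([linear_partials_vanish]), i.e. the 2 x 2 matrix that they form is a multiple
    of a unitary matrix.  Its columns being orthogonal and of equal length, so
    are its rows, and comparing the length of a row with the determinant gives
    the required identity ([unitary_rows]).

    What remains is the local solvability of y'' = - q y with prescribed initial
    values ([complex_linear_ode]), by Picard iteration among holomorphic
    functions.  Primitives are obtained by integration along a horizontal and
    then a vertical segment; they are holomorphic because the derivative of the
    vertical integral with respect to the abscissa is found by differentiating
    under the integral sign ([axis_primitive_partials]).

    A holomorphic function is handled as a pair of real functions of (x, y) whose
    partial derivatives satisfy the Cauchy-Riemann equations ([has_cderiv]);
    complex differentiability itself is recovered at the end
    ([has_cderiv_holomorphic]). *)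

(** * Partial derivatives on open sets of the plane *)

Definition has_partials (D : R -> R -> Prop) (f fx fy : R -> R -> R) : Prop :=
  forall x y, D x y ->
    is_derive (fun s => f s y) x (fx x y) /\ is_derive (fun t => f x t) y (fy x y).

Definition continuous_on_2d (D : R -> R -> Prop) (f : R -> R -> R) : Prop :=
  forall x y, D x y -> continuity_2d_pt f x y.

Definition open_2d (D : R -> R -> Prop) : Prop :=
  forall x y, D x y -> locally_2d D x y.

Definition box (x0 y0 r x y : R) : Prop := Rabs (x - x0) < r /\ Rabs (y - y0) < r.

Lemma box_open x0 y0 r : open_2d (box x0 y0 r).
Proof.
  intros x y [Hx Hy].
  assert (Hd : 0 < Rmin (r - Rabs (x - x0)) (r - Rabs (y - y0))).
  { apply Rmin_pos; lra. }
  exists (mkposreal _ Hd); simpl; intros u v Hu Hv.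
  pose proof (Rmin_l (r - Rabs (x - x0)) (r - Rabs (y - y0))).
  pose proof (Rmin_r (r - Rabs (x - x0)) (r - Rabs (y - y0))).
  split; revert Hx Hy Hu Hv; unfold Rabs in *; repeat destruct Rcase_abs; lra.
Qed.

Lemma segment_in_ball a b r s :
  Rabs (b - a) < r -> Rmin a b <= s <= Rmax a b -> Rabs (s - a) < r.
Proof.
  unfold Rmin, Rmax, Rabs; repeat destruct Rle_dec; repeat destruct Rcase_abs; lra.
Qed.

Lemma center_in_box x0 y0 r x y : box x0 y0 r x y -> box x0 y0 r x0 y0.
Proof.
  intros [Hx Hy]; split; rewrite Rminus_diag, Rabs_R0;
    eapply Rle_lt_trans; try apply Rabs_pos; eassumption.
Qed.

Lemma continuity_2d_line_x f x y :
  continuity_2d_pt f x y -> continuous (fun s => f s y) x.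
Proof.
  intros H; apply (filterlim_locally (fun s => f s y)); intros eps.
  exact (locally_2d_1d_const_y _ _ _ (H eps)).
Qed.

Lemma continuity_2d_line_y f x y :
  continuity_2d_pt f x y -> continuous (fun t => f x t) y.
Proof.
  intros H; apply (filterlim_locally (fun t => f x t)); intros eps.
  exact (locally_2d_1d_const_x _ _ _ (H eps)).
Qed.

Lemma is_derive_continuous_R (f : R -> R) x l : is_derive f x l -> continuous f x.
Proof. intros H; apply (ex_derive_continuous f); exists l; exact H. Qed.

Lemma is_derive_mult_R (f g : R -> R) x df dg :
  is_derive f x df -> is_derive g x dg ->
  is_derive (fun t => f t * g t) x (df * g x + f x * dg).
Proof. intros Hf Hg; apply (is_derive_mult f g x df dg Hf Hg), Rmult_comm. Qed.

Lemma is_derive_div_R (f g : R -> R) x df dg :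
  is_derive f x df -> is_derive g x dg -> g x <> 0 ->
  is_derive (fun t => f t / g t) x ((df * g x - f x * dg) / g x ^ 2).
Proof. intros Hf Hg Hn; exact (is_derive_div f g x df dg Hf Hg Hn). Qed.

Lemma is_derive_plus_R (f g : R -> R) x df dg :
  is_derive f x df -> is_derive g x dg -> is_derive (fun t => f t + g t) x (df + dg).
Proof. intros; apply (is_derive_plus f g); assumption. Qed.
Lemma is_derive_minus_R (f g : R -> R) x df dg :
  is_derive f x df -> is_derive g x dg -> is_derive (fun t => f t - g t) x (df - dg).
Proof. intros; apply (is_derive_minus f g); assumption. Qed.
Lemma is_derive_opp_R (f : R -> R) x df :
  is_derive f x df -> is_derive (fun t => - f t) x (- df).
Proof. intros; apply (is_derive_opp f); assumption. Qed.
Lemma is_derive_const_R (c x : R) : is_derive (fun _ : R => c) x 0.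
Proof. exact (is_derive_const c x). Qed.

Lemma is_derive_eq (f : R -> R) (x l l' : R) : l = l' -> is_derive f x l -> is_derive f x l'.
Proof. intros <-; trivial. Qed.

Lemma is_derive_exp_comp (f : R -> R) x df :
  is_derive f x df -> is_derive (fun t => exp (f t)) x (df * exp (f x)).
Proof. intros Hf; exact (is_derive_comp exp f x _ _ (is_derive_exp _) Hf). Qed.

(** Reads off the derivative of a real expression from its syntax, ending at
    hypotheses; the goals are matched syntactically because unification would
    unfold the arithmetic of [R]. *)
Ltac derive_arith :=
  lazymatch goal with
  | |- is_derive (fun t => @?f t + @?g t) _ _ => eapply (is_derive_plus_R f g); derive_arith
  | |- is_derive (fun t => @?f t - @?g t) _ _ => eapply (is_derive_minus_R f g); derive_arith
  | |- is_derive (fun t => - @?f t) _ _ => eapply (is_derive_opp_R f); derive_arith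
  | |- is_derive (fun t => @?f t * @?g t) _ _ => eapply (is_derive_mult_R f g); derive_arith
  | |- is_derive (fun t => exp (@?f t)) _ _ => eapply (is_derive_exp_comp f); derive_arith
  | |- is_derive (fun _ => ?c) _ _ => exact (is_derive_const_R c _)
  | _ => eassumption
  end.

(** One continuous partial derivative is enough for differentiability, the
    increment in the other variable being taken at the point itself. *)
Lemma has_partials_differentiable D f fx fy x y :
  open_2d D -> has_partials D f fx fy -> continuous_on_2d D fx -> D x y ->
  differentiable_pt_lim f x y (fx x y) (fy x y).
Proof.
  intros HD Hf Hc Hxy; apply filterdiff_differentiable_pt_lim.
  apply (is_derive_filterdiff f x y fx (fy x y)).
  - apply (locally_2d_locally (fun u v => is_derive (fun z => f z v) u (fx u v))).
    destruct (HD x y Hxy) as [d Hd]; exists d; intros u v Hu Hv; apply Hf, Hd; assumption.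
  - apply Hf, Hxy.
  - apply (proj1 (continuity_2d_pt_filterlim fx x y)), Hc, Hxy.
Qed.

Lemma has_partials_continuous D f fx fy :
  open_2d D -> has_partials D f fx fy -> continuous_on_2d D fx -> continuous_on_2d D f.
Proof.
  intros HD Hf Hc x y Hxy; apply differentiable_continuity_pt.
  exists (fx x y), (fy x y); exact (has_partials_differentiable D f fx fy x y HD Hf Hc Hxy).
Qed.

(** * Integration along horizontal and vertical segments *)

(** For a holomorphic u + iv, this is the real part of its integral from
    x0 + i y0 to x + iy along the path through x + i y0. *)
Definition axis_primitive (x0 y0 : R) (u v : R -> R -> R) (x y : R) : R :=
  RInt (fun s => u s y0) x0 x - RInt (fun t => v x t) y0 y.

Lemma ex_RInt_in_ball (f df : R -> R) a b r :
  (forall s, Rabs (s - a) < r -> is_derive f s (df s)) -> Rabs (b - a) < r ->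
  ex_RInt f a b.
Proof.
  intros Hf Hb; apply (ex_RInt_continuous f); intros s Hs.
  apply (is_derive_continuous_R f s (df s)), Hf, (segment_in_ball a b); assumption.
Qed.

Lemma is_derive_RInt_in_ball (f df : R -> R) a b r :
  (forall s, Rabs (s - a) < r -> is_derive f s (df s)) -> Rabs (b - a) < r ->
  is_derive (fun b => RInt f a b) b (f b).
Proof.
  intros Hf Hb.
  apply (is_derive_RInt f (fun b => RInt f a b) a b).
  - assert (Hd : 0 < r - Rabs (b - a)) by lra.
    exists (mkposreal _ Hd); intros c Hc; apply (RInt_correct f).
    apply (ex_RInt_in_ball f df a c r Hf).
    change (Rabs (c - b) < r - Rabs (b - a)) in Hc.
    revert Hb Hc; clear; unfold Rabs; repeat destruct Rcase_abs; lra.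
  - exact (is_derive_continuous_R _ _ _ (Hf b Hb)).
Qed.

(** The derivative in y is that of an integral with respect to its end point.  In
    x, the first integral contributes u (x, y0), and the second, by v_x = - u_y,
    the integral of u_y along the vertical segment, i.e. u (x, y) - u (x, y0). *)
Lemma axis_primitive_partials x0 y0 r u ux uy v vy :
  has_partials (box x0 y0 r) u ux uy ->
  has_partials (box x0 y0 r) v (fun x y => - uy x y) vy ->
  continuous_on_2d (box x0 y0 r) uy ->
  has_partials (box x0 y0 r) (axis_primitive x0 y0 u v) u (fun x y => - v x y).
Proof.
  intros Hu Hv Hc x y Hxy.
  assert (H0 := center_in_box _ _ _ _ _ Hxy); destruct Hxy as [Hx Hy], H0 as [H0x H0y].
  split; unfold axis_primitive.
  - assert (Hint : is_derive (fun x => RInt (fun t => v x t) y0 y) x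
                     (RInt (fun t => Derive (fun s => v s t) x) y0 y)).
    { apply (is_derive_RInt_param (fun x t => v x t) y0 y x).
      - assert (Hd : 0 < r - Rabs (x - x0)) by lra.
        exists (mkposreal _ Hd); intros z Hz t Ht.
        exists (- uy z t); apply Hv; split.
        + change (Rabs (z - x) < r - Rabs (x - x0)) in Hz.
          revert Hx Hz; clear; unfold Rabs; repeat destruct Rcase_abs; lra.
        + exact (segment_in_ball _ _ _ _ Hy Ht).
      - intros t Ht.
        assert (Hb : box x0 y0 r x t) by (split; [exact Hx | exact (segment_in_ball _ _ _ _ Hy Ht)]).
        apply (continuity_2d_pt_ext_loc (fun a b => - uy a b)).
        + destruct (box_open _ _ _ _ _ Hb) as [d Hd]; exists d; intros a b Ha Hb'.
          symmetry; apply is_derive_unique, Hv, Hd; assumption.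
        + apply continuity_2d_pt_opp, Hc, Hb.
      - assert (Hd : 0 < r - Rabs (x - x0)) by lra.
        exists (mkposreal _ Hd); intros z Hz.
        apply (ex_RInt_in_ball _ (fun t => vy z t) y0 y r); [|exact Hy].
        intros t Ht; apply Hv; split; [|exact Ht].
        change (Rabs (z - x) < r - Rabs (x - x0)) in Hz.
        revert Hx Hz; clear; unfold Rabs; repeat destruct Rcase_abs; lra. }
    assert (Hval : RInt (fun t => Derive (fun s => v s t) x) y0 y = u x y0 - u x y).
    { rewrite (RInt_ext _ (fun t => opp (uy x t))).
      - assert (HI : is_RInt (fun t => uy x t) y0 y (minus (u x y) (u x y0))).
        { apply (is_RInt_derive (fun t => u x t)); intros t Ht;
            assert (Hb : box x0 y0 r x t)
              by (split; [exact Hx | exact (segment_in_ball _ _ _ _ Hy Ht)]).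
          - apply Hu, Hb.
          - apply continuity_2d_line_y, Hc, Hb. }
        apply is_RInt_opp in HI.
        transitivity (opp (minus (u x y) (u x y0))); [exact (is_RInt_unique _ _ _ _ HI)|].
        unfold minus, plus, opp; simpl; ring.
      - intros t Ht; apply is_derive_unique, Hv; split; [exact Hx|].
        apply (segment_in_ball _ _ _ _ Hy); lra. }
    rewrite Hval in Hint.
    replace (u x y) with (u x y0 - (u x y0 - u x y)) by ring.
    apply is_derive_minus_R; [|exact Hint].
    apply (is_derive_RInt_in_ball (fun s => u s y0) (fun s => ux s y0) x0 x r); [|exact Hx].
    intros s Hs; apply (Hu s y0); split; assumption.
  - replace (- v x y) with (0 - v x y) by ring.
    apply is_derive_minus_R; [apply is_derive_const_R|].
    apply (is_derive_RInt_in_ball (fun t => v x t) (fun t => vy x t) y0 y r); [|exact Hy].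
    intros t Ht; apply (Hv x t); split; assumption.
Qed.

(** * Holomorphic functions through their partial derivatives *)

Definition re (F : R -> R -> C) (x y : R) : R := fst (F x y).
Definition im (F : R -> R -> C) (x y : R) : R := snd (F x y).

Definition continuous_C (D : R -> R -> Prop) (F : R -> R -> C) : Prop :=
  continuous_on_2d D (re F) /\ continuous_on_2d D (im F).

(** F' is the complex derivative of F: the x-derivative of F is F' and its
    y-derivative is i F'. *)
Definition has_cderiv (D : R -> R -> Prop) (F F' : R -> R -> C) : Prop :=
  has_partials D (re F) (re F') (fun x y => - im F' x y) /\
  has_partials D (im F) (im F') (re F').

Lemma has_cderiv_continuous D F F' :
  open_2d D -> has_cderiv D F F' -> continuous_C D F' -> continuous_C D F.
Proof.
  intros HD [H1 H2] [C1 C2]; split; eapply has_partials_continuous; eassumption.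
Qed.

Lemma has_cderiv_const D c : has_cderiv D (fun _ _ => c) (fun _ _ => RtoC 0).
Proof.
  split; intros x y _; split; try exact (is_derive_const_R _ _).
  unfold im; simpl; rewrite Ropp_0; exact (is_derive_const_R _ _).
Qed.

Lemma has_cderiv_ext D F G F' G' :
  (forall x y, F x y = G x y) -> (forall x y, D x y -> F' x y = G' x y) ->
  has_cderiv D F F' -> has_cderiv D G G'.
Proof.
  intros H1 H2 [HR HI]; split; intros x y Hxy; unfold re, im; rewrite <- (H2 x y Hxy).
  - destruct (HR x y Hxy) as [Hx Hy]; split.
    + apply (is_derive_ext (fun s => re F s y)); [|exact Hx].
      intros t; unfold re; now rewrite H1.
    + apply (is_derive_ext (fun t => re F x t)); [|exact Hy].
      intros t; unfold re; now rewrite H1.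
  - destruct (HI x y Hxy) as [Hx Hy]; split.
    + apply (is_derive_ext (fun s => im F s y)); [|exact Hx].
      intros t; unfold im; now rewrite H1.
    + apply (is_derive_ext (fun t => im F x t)); [|exact Hy].
      intros t; unfold im; now rewrite H1.
Qed.

Lemma has_cderiv_plus D F G F' G' :
  has_cderiv D F F' -> has_cderiv D G G' ->
  has_cderiv D (fun x y => F x y + G x y)%C (fun x y => F' x y + G' x y)%C.
Proof.
  intros [F1 F2] [G1 G2]; split; intros x y Hxy;
    specialize (F1 x y Hxy); specialize (F2 x y Hxy);
    specialize (G1 x y Hxy); specialize (G2 x y Hxy);
    unfold re, im in *; simpl; split; try rewrite Ropp_plus_distr;
    apply is_derive_plus_R; tauto.
Qed.

Lemma has_cderiv_opp D F F' :
  has_cderiv D F F' -> has_cderiv D (fun x y => - F x y)%C (fun x y => - F' x y)%C.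
Proof.
  intros [F1 F2]; split; intros x y Hxy;
    specialize (F1 x y Hxy); specialize (F2 x y Hxy);
    unfold re, im in *; simpl; split; apply is_derive_opp_R; tauto.
Qed.

Lemma has_cderiv_mult D F G F' G' :
  has_cderiv D F F' -> has_cderiv D G G' ->
  has_cderiv D (fun x y => F x y * G x y)%C
    (fun x y => F' x y * G x y + F x y * G' x y)%C.
Proof.
  intros [F1 F2] [G1 G2]; split; intros x y Hxy;
    destruct (F1 x y Hxy), (F2 x y Hxy), (G1 x y Hxy), (G2 x y Hxy);
    unfold re, im in *; simpl; split;
    (eapply is_derive_eq; [| derive_arith]); simpl; ring.
Qed.

Lemma continuous_C_plus D F G :
  continuous_C D F -> continuous_C D G -> continuous_C D (fun x y => F x y + G x y)%C.
Proof.
  intros [F1 F2] [G1 G2]; split; intros x y Hxy;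
    [apply (continuity_2d_pt_plus (re F) (re G)) | apply (continuity_2d_pt_plus (im F) (im G))];
    auto.
Qed.

Lemma continuous_C_opp D F : continuous_C D F -> continuous_C D (fun x y => - F x y)%C.
Proof.
  intros [F1 F2]; split; intros x y Hxy;
    [apply (continuity_2d_pt_opp (re F)) | apply (continuity_2d_pt_opp (im F))]; auto.
Qed.

Lemma continuous_C_mult D F G :
  continuous_C D F -> continuous_C D G -> continuous_C D (fun x y => F x y * G x y)%C.
Proof.
  intros [F1 F2] [G1 G2]; split; intros x y Hxy.
  - apply (continuity_2d_pt_minus (fun x y => re F x y * re G x y) (fun x y => im F x y * im G x y));
      apply continuity_2d_pt_mult; auto.
  - apply (continuity_2d_pt_plus (fun x y => re F x y * im G x y) (fun x y => im F x y * re G x y));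
      apply continuity_2d_pt_mult; auto.
Qed.

Lemma continuous_C_const D c : continuous_C D (fun _ _ => c).
Proof. split; intros x y _; apply continuity_2d_pt_const. Qed.

(** The imaginary part of the integral of F is the real part of that of - i F. *)
Definition primitive (x0 y0 : R) (F : R -> R -> C) (x y : R) : C :=
  (axis_primitive x0 y0 (re F) (im F) x y,
   axis_primitive x0 y0 (im F) (fun x y => - re F x y) x y).

Lemma primitive_has_cderiv x0 y0 r F F' :
  has_cderiv (box x0 y0 r) F F' -> continuous_C (box x0 y0 r) F' ->
  has_cderiv (box x0 y0 r) (primitive x0 y0 F) F.
Proof.
  intros [H1 H2] [C1 C2]; split.
  - apply (axis_primitive_partials x0 y0 r (re F) (re F') (fun x y => - im F' x y) (im F) (re F')).
    + exact H1.
    + intros x y Hxy; rewrite Ropp_involutive; exact (H2 x y Hxy).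
    + intros x y Hxy; apply continuity_2d_pt_opp, C2, Hxy.
  - intros x y Hxy.
    destruct (axis_primitive_partials x0 y0 r (im F) (im F') (re F')
                (fun x y => - re F x y) (im F')) with (3 := C1) (x := x) (y := y) as [Px Py];
      trivial.
    + intros a b Hab; destruct (H1 a b Hab) as [Hx Hy]; split.
      * exact (is_derive_opp_R _ _ _ Hx).
      * eapply is_derive_eq; [|exact (is_derive_opp_R _ _ _ Hy)]; ring.
    + split; [exact Px|].
      eapply is_derive_eq; [|exact Py]; ring.
Qed.

Lemma primitive_center x0 y0 F : primitive x0 y0 F x0 y0 = RtoC 0.
Proof.
  unfold primitive, axis_primitive, RtoC.
  f_equal; rewrite !RInt_point; unfold zero; simpl; ring.
Qed.

Lemma primitive_zero x0 y0 F x y :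
  (forall s t, F s t = RtoC 0) -> primitive x0 y0 F x y = RtoC 0.
Proof.
  intros H.
  assert (Z : forall (f : R -> R) c d, (forall s, f s = 0) -> RInt f c d = 0).
  { intros f c d Hf; rewrite (RInt_ext f (fun _ => 0)) by (intros; apply Hf).
    rewrite RInt_const; apply Rmult_0_r. }
  unfold primitive, axis_primitive, re, im, RtoC.
  rewrite !Z; try (intros s; rewrite H; simpl; ring).
  f_equal; ring.
Qed.

(** * Uniform convergence at a geometric rate *)

Definition close_on (D : R -> R -> Prop) (F G : R -> R -> C) (M : R) : Prop :=
  forall x y, D x y ->
    Rabs (re F x y - re G x y) <= M /\ Rabs (im F x y - im G x y) <= M.

Lemma RInt_difference_le (f g : R -> R) a b r M :
  (forall s, Rabs (s - a) < r -> continuous f s) ->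
  (forall s, Rabs (s - a) < r -> continuous g s) ->
  (forall s, Rabs (s - a) < r -> Rabs (f s - g s) <= M) ->
  Rabs (b - a) < r ->
  Rabs (RInt f a b - RInt g a b) <= r * M.
Proof.
  intros Hf Hg HM Hb.
  assert (Ef : ex_RInt f a b).
  { apply (ex_RInt_continuous f); intros s Hs; apply Hf, (segment_in_ball a b); assumption. }
  assert (Eg : ex_RInt g a b).
  { apply (ex_RInt_continuous g); intros s Hs; apply Hg, (segment_in_ball a b); assumption. }
  assert (M0 : 0 <= M).
  { eapply Rle_trans; [apply Rabs_pos | apply (HM a)].
    rewrite Rminus_diag, Rabs_R0; eapply Rle_lt_trans; [apply Rabs_pos | exact Hb]. }
  apply Rle_trans with (Rabs (b - a) * M).
  - apply (norm_RInt_le_const_abs (fun s => minus (f s) (g s)) a b).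
    + intros s Hs; apply HM, (segment_in_ball a b); assumption.
    + apply (is_RInt_minus f g); apply (RInt_correct (V := R_CompleteNormedModule)); assumption.
  - apply Rmult_le_compat_r; lra.
Qed.

Lemma axis_primitive_close x0 y0 r u v u' v' M :
  continuous_on_2d (box x0 y0 r) u -> continuous_on_2d (box x0 y0 r) v ->
  continuous_on_2d (box x0 y0 r) u' -> continuous_on_2d (box x0 y0 r) v' ->
  (forall x y, box x0 y0 r x y -> Rabs (u x y - u' x y) <= M) ->
  (forall x y, box x0 y0 r x y -> Rabs (v x y - v' x y) <= M) ->
  forall x y, box x0 y0 r x y ->
    Rabs (axis_primitive x0 y0 u v x y - axis_primitive x0 y0 u' v' x y) <= 2 * r * M.
Proof.
  intros Cu Cv Cu' Cv' Hu Hv x y Hxy.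
  assert (H0 := center_in_box _ _ _ _ _ Hxy); destruct Hxy as [Hx Hy], H0 as [H0x H0y].
  assert (B1 : Rabs (RInt (fun s => u s y0) x0 x - RInt (fun s => u' s y0) x0 x) <= r * M).
  { apply RInt_difference_le; trivial; intros s Hs; try apply Hu;
      try apply (continuity_2d_line_x u); try apply (continuity_2d_line_x u');
      try apply Cu; try apply Cu'; split; assumption. }
  assert (B2 : Rabs (RInt (fun t => v x t) y0 y - RInt (fun t => v' x t) y0 y) <= r * M).
  { apply RInt_difference_le; trivial; intros s Hs; try apply Hv;
      try apply (continuity_2d_line_y v); try apply (continuity_2d_line_y v');
      try apply Cv; try apply Cv'; split; assumption. }
  unfold axis_primitive; revert B1 B2.
  generalize (RInt (fun s => u s y0) x0 x) (RInt (fun s => u' s y0) x0 x)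
    (RInt (fun t => v x t) y0 y) (RInt (fun t => v' x t) y0 y).
  intros p1 p2 p3 p4 B1 B2.
  apply Rabs_le_between in B1; apply Rabs_le_between in B2; apply Rabs_le_between; lra.
Qed.

Lemma primitive_close x0 y0 r F G M :
  continuous_C (box x0 y0 r) F -> continuous_C (box x0 y0 r) G ->
  close_on (box x0 y0 r) F G M ->
  close_on (box x0 y0 r) (primitive x0 y0 F) (primitive x0 y0 G) (2 * r * M).
Proof.
  intros [F1 F2] [G1 G2] H x y Hxy; split.
  - apply (axis_primitive_close x0 y0 r (re F) (im F) (re G) (im G)); trivial;
      intros a b Hab; apply (H a b Hab).
  - apply (axis_primitive_close x0 y0 r (im F) (fun x y => - re F x y)
             (im G) (fun x y => - re G x y)); trivial.
    + intros a b Hab; apply continuity_2d_pt_opp, F1, Hab.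
    + intros a b Hab; apply continuity_2d_pt_opp, G1, Hab.
    + intros a b Hab; apply (H a b Hab).
    + intros a b Hab.
      replace (- re F a b - - re G a b) with (- (re F a b - re G a b)) by ring.
      rewrite Rabs_Ropp; apply (H a b Hab).
Qed.

Lemma close_on_mult_l D q F G Q M :
  (forall x y, D x y -> Rabs (re q x y) <= Q /\ Rabs (im q x y) <= Q) ->
  close_on D F G M ->
  close_on D (fun x y => q x y * F x y)%C (fun x y => q x y * G x y)%C (2 * Q * M).
Proof.
  intros Hq H x y Hxy; destruct (Hq x y Hxy) as [Q1 Q2], (H x y Hxy) as [H1 H2].
  unfold re, im in *; simpl.
  revert Q1 Q2 H1 H2.
  generalize (fst (q x y)) (snd (q x y)) (fst (F x y)) (snd (F x y)) (fst (G x y)) (snd (G x y)).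
  intros q1 q2 f1 f2 g1 g2 Q1 Q2 H1 H2.
  assert (P : forall s t, Rabs s <= Q -> Rabs t <= M -> Rabs (s * t) <= Q * M).
  { intros s t Hs Ht; rewrite Rabs_mult; apply Rmult_le_compat; trivial; apply Rabs_pos. }
  pose proof (P _ _ Q1 H1) as A; pose proof (P _ _ Q2 H2) as B.
  pose proof (P _ _ Q1 H2) as A'; pose proof (P _ _ Q2 H1) as B'.
  apply Rabs_le_between in A; apply Rabs_le_between in B.
  apply Rabs_le_between in A'; apply Rabs_le_between in B'.
  split; apply Rabs_le_between; lra.
Qed.

Lemma close_on_const_plus D c F G M :
  close_on D F G M -> close_on D (fun x y => c + F x y)%C (fun x y => c + G x y)%C M.
Proof.
  intros H x y Hxy; destruct (H x y Hxy) as [H1 H2]; unfold re, im in *; simpl.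
  split; [replace (_ - _) with (fst (F x y) - fst (G x y)) by ring
         |replace (_ - _) with (snd (F x y) - snd (G x y)) by ring]; assumption.
Qed.

Lemma close_on_opp D F G M :
  close_on D F G M -> close_on D (fun x y => - F x y)%C (fun x y => - G x y)%C M.
Proof.
  intros H x y Hxy; destruct (H x y Hxy) as [H1 H2]; unfold re, im in *; simpl.
  split; [replace (_ - _) with (- (fst (F x y) - fst (G x y))) by ring
         |replace (_ - _) with (- (snd (F x y) - snd (G x y))) by ring];
    rewrite Rabs_Ropp; assumption.
Qed.

Lemma close_on_weaken D F G M M' : M <= M' -> close_on D F G M -> close_on D F G M'.
Proof. intros HM H x y Hxy; destruct (H x y Hxy); split; lra. Qed.

Lemma geometric_small K eps : 0 < eps -> exists N, forall n, (N <= n)%nat -> K / 2 ^ n < eps.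
Proof.
  intros He.
  assert (HK : 0 < Rabs K + 1) by (pose proof (Rabs_pos K); lra).
  destruct (pow_lt_1_zero (/ 2)) with (y := eps / (Rabs K + 1)) as [N HN].
  - rewrite Rabs_pos_eq; lra.
  - apply Rdiv_lt_0_compat; lra.
  - exists N; intros n Hn; specialize (HN n Hn).
    rewrite pow_inv in HN.
    assert (Hp : 0 < / 2 ^ n) by (apply Rinv_0_lt_compat, pow_lt; lra).
    rewrite Rabs_pos_eq in HN by lra.
    apply Rle_lt_trans with ((Rabs K + 1) * / 2 ^ n).
    + apply Rmult_le_compat_r; [lra|]; pose proof (Rle_abs K); lra.
    + apply (Rmult_lt_compat_l (Rabs K + 1)) in HN; [|lra].
      replace ((Rabs K + 1) * (eps / (Rabs K + 1))) with eps in HN by (field; lra).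
      exact HN.
Qed.

Lemma geometric_limit_unique K a l : (forall n, Rabs (a - l) <= K / 2 ^ n) -> a = l.
Proof.
  intros H; destruct (Req_dec a l) as [E|E]; trivial.
  assert (P : 0 < Rabs (a - l)) by (apply Rabs_pos_lt; lra).
  destruct (geometric_small K _ P) as [N HN].
  specialize (HN N (le_n N)); specialize (H N); lra.
Qed.

(** The remainders of the sum of the increments are geometric as well, so the
    sequence is Cauchy and the bound passes to the limit. *)
Lemma geometric_increments u K :
  (forall n, Rabs (u (S n) - u n) <= K / 2 ^ n) ->
  forall n, Rabs (u n - real (Lim_seq u)) <= 2 * K / 2 ^ n.
Proof.
  intros H.
  assert (K0 : 0 <= K).
  { specialize (H 0%nat); pose proof (Rabs_pos (u 1%nat - u 0%nat)); simpl in H; lra. }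
  assert (T : forall n k, Rabs (u (n + k)%nat - u n) <= 2 * K / 2 ^ n - 2 * K / 2 ^ (n + k)).
  { intros n; induction k as [|k IH].
    - rewrite Nat.add_0_r, !Rminus_diag, Rabs_R0; lra.
    - rewrite Nat.add_succ_r; specialize (H (n + k)%nat).
      assert (E : 2 * K / 2 ^ S (n + k) = K / 2 ^ (n + k)).
      { simpl; field; apply pow_nonzero; lra. }
      rewrite E.
      replace (u (S (n + k)) - u n) with ((u (S (n + k)) - u (n + k)%nat) + (u (n + k)%nat - u n)) by ring.
      eapply Rle_trans; [apply Rabs_triang|]. unfold Rdiv in *; lra. }
  assert (T' : forall n m, (n <= m)%nat -> Rabs (u m - u n) <= 2 * K / 2 ^ n).
  { intros n m Hnm; replace m with (n + (m - n))%nat by lia.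
    eapply Rle_trans; [apply T|].
    assert (0 <= 2 * K / 2 ^ (n + (m - n))).
    { apply Rmult_le_pos; [lra|]; apply Rlt_le, Rinv_0_lt_compat, pow_lt; lra. }
    lra. }
  assert (F : ex_finite_lim_seq u).
  { apply ex_lim_seq_cauchy_corr; intros eps.
    assert (He : 0 < eps / 2) by (destruct eps; simpl; lra).
    destruct (geometric_small (2 * K) _ He) as [N HN]; exists N; intros n m Hn Hm.
    pose proof (T' N n Hn) as A; pose proof (T' N m Hm) as B; specialize (HN N (le_n N)).
    apply Rabs_le_between in A; apply Rabs_le_between in B.
    apply Rabs_def1; lra. }
  intros n; apply Lim_seq_correct' in F.
  rewrite Rabs_minus_sym.
  apply (is_lim_seq_le_loc (fun m => Rabs (u m - u n)) (fun _ => 2 * K / 2 ^ n)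
           (Finite (Rabs (real (Lim_seq u) - u n))) (Finite (2 * K / 2 ^ n))).
  - exists n; exact (T' n).
  - apply (is_lim_seq_abs (fun m => u m - u n) (Finite (real (Lim_seq u) - u n))).
    apply (is_lim_seq_minus' u (fun _ => u n)); [exact F | apply is_lim_seq_const].
  - apply is_lim_seq_const.
Qed.

Lemma is_derive_uniform_limit c r (f f' : nat -> R -> R) (g g' : R -> R) K :
  (forall n x, Rabs (x - c) < r -> is_derive (f n) x (f' n x)) ->
  (forall n x, Rabs (x - c) < r -> Rabs (f n x - g x) <= K / 2 ^ n) ->
  (forall n x, Rabs (x - c) < r -> Rabs (f' n x - g' x) <= K / 2 ^ n) ->
  forall x, Rabs (x - c) < r -> is_derive g x (g' x).
Proof.
  intros Hd Hf Hf' x Hx.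
  assert (r0 : 0 < r) by (eapply Rle_lt_trans; [apply Rabs_pos | exact Hx]).
  apply is_derive_Reals, (CVU_derivable f f' g g' c (mkposreal r r0)).
  - intros eps He; destruct (geometric_small K eps He) as [N HN]; exists N; intros n y Hn Hy.
    rewrite Rabs_minus_sym; eapply Rle_lt_trans; [exact (Hf' n y Hy) | exact (HN n Hn)].
  - intros y Hy eps He; destruct (geometric_small K eps He) as [N HN]; exists N; intros n Hn.
    eapply Rle_lt_trans; [exact (Hf n y Hy) | exact (HN n Hn)].
  - intros n y Hy; apply is_derive_Reals, Hd, Hy.
  - exact Hx.
Qed.

Lemma has_cderiv_uniform_limit x0 y0 r (F F' : nat -> R -> R -> C) G G' K :
  (forall n, has_cderiv (box x0 y0 r) (F n) (F' n)) ->
  (forall n, close_on (box x0 y0 r) (F n) G (K / 2 ^ n)) ->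
  (forall n, close_on (box x0 y0 r) (F' n) G' (K / 2 ^ n)) ->
  has_cderiv (box x0 y0 r) G G'.
Proof.
  intros Hd H H'; split; intros x y [Hx Hy]; split.
  - apply (is_derive_uniform_limit x0 r (fun n s => re (F n) s y) (fun n s => re (F' n) s y)
             (fun s => re G s y) (fun s => re G' s y) K); trivial; intros n s Hs.
    + apply (Hd n); split; assumption.
    + apply (H n); split; assumption.
    + apply (H' n); split; assumption.
  - apply (is_derive_uniform_limit y0 r (fun n t => re (F n) x t) (fun n t => - im (F' n) x t)
             (fun t => re G x t) (fun t => - im G' x t) K); trivial; intros n t Ht.
    + apply (Hd n); split; assumption.
    + apply (H n); split; assumption.
    + replace (- im (F' n) x t - - im G' x t) with (- (im (F' n) x t - im G' x t)) by ring.
      rewrite Rabs_Ropp; apply (H' n); split; assumption.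
  - apply (is_derive_uniform_limit x0 r (fun n s => im (F n) s y) (fun n s => im (F' n) s y)
             (fun s => im G s y) (fun s => im G' s y) K); trivial; intros n s Hs.
    + apply (Hd n); split; assumption.
    + apply (H n); split; assumption.
    + apply (H' n); split; assumption.
  - apply (is_derive_uniform_limit y0 r (fun n t => im (F n) x t) (fun n t => re (F' n) x t)
             (fun t => im G x t) (fun t => re G' x t) K); trivial; intros n t Ht.
    + apply (Hd n); split; assumption.
    + apply (H n); split; assumption.
    + apply (H' n); split; assumption.
Qed.

Lemma continuous_on_2d_uniform_limit D (f : nat -> R -> R -> R) g K :
  open_2d D -> (forall n, continuous_on_2d D (f n)) ->
  (forall n x y, D x y -> Rabs (f n x y - g x y) <= K / 2 ^ n) ->
  continuous_on_2d D g.
Proof.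
  intros HD Hf H x y Hxy eps.
  assert (He : 0 < eps / 3) by (destruct eps; simpl; lra).
  destruct (geometric_small K _ He) as [N HN]; specialize (HN N (le_n N)).
  destruct (HD x y Hxy) as [d1 H1], (Hf N x y Hxy (mkposreal _ He)) as [d2 H2]; simpl in H2.
  exists (mkposreal _ (Rmin_stable_in_posreal d1 d2)); simpl; intros u v Hu Hv.
  assert (Duv : D u v).
  { apply H1; eapply Rlt_le_trans; try eassumption; apply Rmin_l. }
  assert (B : Rabs (f N u v - f N x y) < eps / 3).
  { apply H2; eapply Rlt_le_trans; try eassumption; apply Rmin_r. }
  pose proof (H N x y Hxy) as A; pose proof (H N u v Duv) as A'.
  apply Rabs_le_between in A; apply Rabs_le_between in A'; apply Rabs_def2 in B.
  apply Rabs_def1; lra.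
Qed.

Lemma continuous_C_uniform_limit D (F : nat -> R -> R -> C) G K :
  open_2d D -> (forall n, continuous_C D (F n)) ->
  (forall n, close_on D (F n) G (K / 2 ^ n)) -> continuous_C D G.
Proof.
  intros HD HF H; split.
  - apply (continuous_on_2d_uniform_limit D (fun n => re (F n)) _ K HD).
    + intros n; apply HF.
    + intros n x y Hxy; apply (H n x y Hxy).
  - apply (continuous_on_2d_uniform_limit D (fun n => im (F n)) _ K HD).
    + intros n; apply HF.
    + intros n x y Hxy; apply (H n x y Hxy).
Qed.

(** * Picard iteration for y'' = - q y *)

(** The equation is treated as the system y' = e, e' = - q y, with initial values
    a and b.  Starting from zero functions makes the first increments the
    constants a and b. *)
Fixpoint picard (x0 y0 : R) (q : R -> R -> C) (a b : C) (n : nat) :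
  (R -> R -> C) * (R -> R -> C) :=
  match n with
  | O => (fun _ _ => RtoC 0, fun _ _ => RtoC 0)
  | S n =>
      let (Y, E) := picard x0 y0 q a b n in
      (fun x y => a + primitive x0 y0 E x y,
       fun x y => b + - primitive x0 y0 (fun s t => q s t * Y s t) x y)%C
  end.

(** The bounds on r make the integral operators contract by 1/2: integration
    over the box costs a factor 2 r, and multiplication by q a factor 2 Q in
    terms of the larger of the real and imaginary parts.  The iterates stay
    holomorphic with derivatives known explicitly, and these derivatives converge
    uniformly too, so the limits solve the system. *)
Lemma complex_linear_ode x0 y0 r q q' Q a b :
  0 < r -> r <= 1 / 4 -> r * Q <= 1 / 8 ->
  has_cderiv (box x0 y0 r) q q' -> continuous_C (box x0 y0 r) q' ->
  (forall x y, box x0 y0 r x y -> Rabs (re q x y) <= Q /\ Rabs (im q x y) <= Q) ->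
  exists Y E : R -> R -> C,
    has_cderiv (box x0 y0 r) Y E /\
    has_cderiv (box x0 y0 r) E (fun x y => - (q x y * Y x y))%C /\
    continuous_C (box x0 y0 r) Y /\
    Y x0 y0 = a /\ E x0 y0 = b.
Proof.
  intros r0 r4 rQ Hq Cq' HQ.
  set (B := box x0 y0 r) in *.
  assert (HB : open_2d B) by apply box_open.
  assert (B0 : B x0 y0).
  { split; rewrite Rminus_diag, Rabs_R0; exact r0. }
  assert (Cq : continuous_C B q) by exact (has_cderiv_continuous B q q' HB Hq Cq').
  assert (Q0 : 0 <= Q).
  { eapply Rle_trans; [apply Rabs_pos | apply (HQ x0 y0 B0)]. }
  set (Y := fun n => fst (picard x0 y0 q a b n)).
  set (E := fun n => snd (picard x0 y0 q a b n)).
  assert (YS : forall n, Y (S n) = (fun x y => a + primitive x0 y0 (E n) x y)%C).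
  { intros n; unfold Y, E; simpl; destruct (picard x0 y0 q a b n); reflexivity. }
  assert (ES : forall n, E (S n) =
     (fun x y => b + - primitive x0 y0 (fun s t => q s t * Y n s t) x y)%C).
  { intros n; unfold Y, E; simpl; destruct (picard x0 y0 q a b n); reflexivity. }
  assert (Step : forall n Y' E',
     has_cderiv B (Y n) Y' -> continuous_C B Y' ->
     has_cderiv B (E n) E' -> continuous_C B E' ->
     has_cderiv B (Y (S n)) (E n) /\
     has_cderiv B (E (S n)) (fun x y => - (q x y * Y n x y))%C).
  { intros n Y' E' HY CY HE CE; split.
    - rewrite YS.
      eapply has_cderiv_ext;
        [intros; reflexivity | |
         apply has_cderiv_plus; [apply has_cderiv_const | exact (primitive_has_cderiv _ _ _ _ _ HE CE)]].
      intros x y _; apply Cplus_0_l.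
    - rewrite ES.
      eapply has_cderiv_ext;
        [intros; reflexivity | |
         apply has_cderiv_plus; [apply has_cderiv_const |
         apply has_cderiv_opp;
         refine (primitive_has_cderiv _ _ _ _ _ (has_cderiv_mult _ _ _ _ _ Hq HY) _)]].
      + intros x y _; apply Cplus_0_l.
      + apply continuous_C_plus; apply continuous_C_mult; trivial.
        exact (has_cderiv_continuous B _ _ HB HY CY). }
  assert (Inv : forall n, exists Y' E',
     has_cderiv B (Y n) Y' /\ continuous_C B Y' /\
     has_cderiv B (E n) E' /\ continuous_C B E').
  { induction n as [|n [Y' [E' [HY [CY [HE CE]]]]]].
    - exists (fun _ _ => RtoC 0), (fun _ _ => RtoC 0).
      split; [exact (has_cderiv_const B (RtoC 0))|].
      split; [exact (continuous_C_const B (RtoC 0))|].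
      split; [exact (has_cderiv_const B (RtoC 0)) | exact (continuous_C_const B (RtoC 0))].
    - destruct (Step n Y' E' HY CY HE CE) as [S1 S2].
      exists (E n), (fun x y => - (q x y * Y n x y))%C; split; [exact S1|split; [|split; [exact S2|]]].
      + exact (has_cderiv_continuous B _ _ HB HE CE).
      + apply continuous_C_opp, continuous_C_mult; trivial.
        exact (has_cderiv_continuous B _ _ HB HY CY). }
  assert (CY : forall n, continuous_C B (Y n)).
  { intros n; destruct (Inv n) as [Y' [E' [H1 [H2 _]]]].
    exact (has_cderiv_continuous B _ _ HB H1 H2). }
  assert (CE : forall n, continuous_C B (E n)).
  { intros n; destruct (Inv n) as [Y' [E' [_ [_ [H1 H2]]]]].
    exact (has_cderiv_continuous B _ _ HB H1 H2). }
  set (K := Cmod a + Cmod b).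
  assert (Ka : Rabs (fst a) <= K /\ Rabs (snd a) <= K).
  { pose proof (Rmax_Cmod a) as Ha; pose proof (Cmod_ge_0 b).
    pose proof (Rmax_l (Rabs (fst a)) (Rabs (snd a))).
    pose proof (Rmax_r (Rabs (fst a)) (Rabs (snd a))). unfold K; lra. }
  assert (Kb : Rabs (fst b) <= K /\ Rabs (snd b) <= K).
  { pose proof (Rmax_Cmod b) as Hb; pose proof (Cmod_ge_0 a).
    pose proof (Rmax_l (Rabs (fst b)) (Rabs (snd b))).
    pose proof (Rmax_r (Rabs (fst b)) (Rabs (snd b))). unfold K; lra. }
  assert (K0 : 0 <= K).
  { unfold K; pose proof (Cmod_ge_0 a); pose proof (Cmod_ge_0 b); lra. }
  assert (Incr : forall n, close_on B (Y (S n)) (Y n) (K / 2 ^ n) /\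
                           close_on B (E (S n)) (E n) (K / 2 ^ n)).
  { induction n as [|n [IY IE]].
    - split.
      + intros x y Hxy; rewrite YS; unfold re, im.
        rewrite primitive_zero by reflexivity; simpl.
        destruct Ka; split; rewrite Rplus_0_r, Rminus_0_r, Rdiv_1_r; assumption.
      + intros x y Hxy; rewrite ES; unfold re, im.
        rewrite primitive_zero by (intros s t; apply Cmult_0_r); simpl.
        destruct Kb; split; rewrite Ropp_0, Rplus_0_r, Rminus_0_r, Rdiv_1_r; assumption.
    - assert (P : 0 < / 2 ^ n) by (apply Rinv_0_lt_compat, pow_lt; lra).
      assert (HK : 0 <= K / 2 ^ n) by (apply Rmult_le_pos; lra).
      assert (EK : K / 2 ^ S n = K / 2 ^ n / 2) by (simpl; field; apply pow_nonzero; lra).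
      rewrite EK; split.
      + rewrite (YS (S n)), (YS n) at 1; apply close_on_const_plus.
        apply (close_on_weaken _ _ _ (2 * r * (K / 2 ^ n))); [nra|].
        apply primitive_close; [apply CE | apply CE | exact IE].
      + rewrite (ES (S n)), (ES n) at 1; apply close_on_const_plus, close_on_opp.
        apply (close_on_weaken _ _ _ (2 * r * (2 * Q * (K / 2 ^ n)))); [nra|].
        apply primitive_close; try (apply continuous_C_mult; [exact Cq | apply CY]).
        apply close_on_mult_l; [exact HQ | exact IY]. }
  set (Yl := fun x y => (real (Lim_seq (fun n => re (Y n) x y)),
                         real (Lim_seq (fun n => im (Y n) x y))) : C).
  set (El := fun x y => (real (Lim_seq (fun n => re (E n) x y)),
                         real (Lim_seq (fun n => im (E n) x y))) : C).
  assert (LY : forall n, close_on B (Y n) Yl (2 * K / 2 ^ n)).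
  { intros n x y Hxy; split.
    - apply (geometric_increments (fun n => re (Y n) x y)); intros m; apply (Incr m); exact Hxy.
    - apply (geometric_increments (fun n => im (Y n) x y)); intros m; apply (Incr m); exact Hxy. }
  assert (LE : forall n, close_on B (E n) El (2 * K / 2 ^ n)).
  { intros n x y Hxy; split.
    - apply (geometric_increments (fun n => re (E n) x y)); intros m; apply (Incr m); exact Hxy.
    - apply (geometric_increments (fun n => im (E n) x y)); intros m; apply (Incr m); exact Hxy. }
  assert (Pow : forall M N n, 0 <= M -> M <= N -> M / 2 ^ S n <= N / 2 ^ n).
  { intros M N n HM HN.
    assert (P : 0 < / 2 ^ n) by (apply Rinv_0_lt_compat, pow_lt; lra).
    replace (M / 2 ^ S n) with (M / 2 * / 2 ^ n) by (simpl; field; apply pow_nonzero; lra).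
    apply Rmult_le_compat_r; lra. }
  assert (DY : forall n, has_cderiv B (Y (S n)) (E n) /\
     has_cderiv B (E (S n)) (fun x y => - (q x y * Y n x y))%C).
  { intros n; destruct (Inv n) as [Y' [E' [H1 [H2 [H3 H4]]]]]; exact (Step n Y' E' H1 H2 H3 H4). }
  exists Yl, El; split; [|split; [|split; [|split]]].
  - apply (has_cderiv_uniform_limit x0 y0 r (fun n => Y (S n)) E _ _ (2 * K)).
    + intros n; apply DY.
    + intros n; eapply close_on_weaken; [|apply LY]; apply Pow; lra.
    + exact LE.
  - apply (has_cderiv_uniform_limit x0 y0 r (fun n => E (S n))
             (fun n x y => - (q x y * Y n x y))%C _ _ (2 * K + 2 * Q * (2 * K))).
    + intros n; apply DY.
    + intros n; eapply close_on_weaken; [|apply LE]; apply Pow; nra.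
    + intros n; apply close_on_opp.
      apply (close_on_weaken _ _ _ (2 * Q * (2 * K / 2 ^ n))).
      * assert (P : 0 < / 2 ^ n) by (apply Rinv_0_lt_compat, pow_lt; lra).
        unfold Rdiv; rewrite <- Rmult_assoc; apply Rmult_le_compat_r; nra.
      * apply close_on_mult_l; [exact HQ | apply LY].
  - exact (continuous_C_uniform_limit B Y Yl (2 * K) HB CY LY).
  - assert (H : forall n, Y (S n) x0 y0 = a).
    { intros n; rewrite YS, primitive_center; apply Cplus_0_r. }
    rewrite (surjective_pairing a); unfold Yl; f_equal; symmetry.
    + apply (geometric_limit_unique (2 * K)); intros n; rewrite <- (H n).
      eapply Rle_trans; [apply (LY (S n)); exact B0 | apply Pow; lra].
    + apply (geometric_limit_unique (2 * K)); intros n; rewrite <- (H n).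
      eapply Rle_trans; [apply (LY (S n)); exact B0 | apply Pow; lra].
  - assert (H : forall n, E (S n) x0 y0 = b).
    { intros n; rewrite ES, primitive_center.
      replace (- RtoC 0)%C with (RtoC 0) by (unfold RtoC, Copp; simpl; now rewrite Ropp_0).
      apply Cplus_0_r. }
    rewrite (surjective_pairing b); unfold El; f_equal; symmetry.
    + apply (geometric_limit_unique (2 * K)); intros n; rewrite <- (H n).
      eapply Rle_trans; [apply (LE (S n)); exact B0 | apply Pow; lra].
    + apply (geometric_limit_unique (2 * K)); intros n; rewrite <- (H n).
      eapply Rle_trans; [apply (LE (S n)); exact B0 | apply Pow; lra].
Qed.

(** * Quotients and complex differentiability *)

Lemma is_derive_over_norm (f g h : R -> R) x f' g' h' :
  is_derive f x f' -> is_derive g x g' -> is_derive h x h' -> f x ^ 2 + g x ^ 2 <> 0 ->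
  is_derive (fun t => h t / (f t ^ 2 + g t ^ 2)) x
    ((h' * (f x ^ 2 + g x ^ 2) - h x * (2 * f x * f' + 2 * g x * g')) / (f x ^ 2 + g x ^ 2) ^ 2).
Proof.
  intros Hf Hg Hh Hn; apply (is_derive_div_R h (fun t => f t ^ 2 + g t ^ 2)); trivial.
  apply (is_derive_ext (fun t => f t * f t + g t * g t)).
  - intros t; simpl; rewrite !Rmult_1_r; reflexivity.
  - eapply is_derive_eq; [|derive_arith]; ring.
Qed.

Lemma has_cderiv_inv D F F' :
  (forall x y, D x y -> F x y <> RtoC 0) -> has_cderiv D F F' ->
  has_cderiv D (fun x y => / F x y)%C (fun x y => - (F' x y * / (F x y * F x y)))%C.
Proof.
  intros Hn [F1 F2].
  (* Nonvanishing of |F|^4 as [field] expands it. *)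
  assert (Hsq : forall a b, a ^ 2 + b ^ 2 <> 0 -> a ^ 4 + 2 * a ^ 2 * b ^ 2 + b ^ 4 <> 0).
  { intros a b H E; apply H.
    assert (E' : (a ^ 2 + b ^ 2) * (a ^ 2 + b ^ 2) = 0) by (rewrite <- E; ring).
    apply Rmult_integral in E'; lra. }
  assert (Hs : forall x y, D x y -> fst (F x y) ^ 2 + snd (F x y) ^ 2 <> 0).
  { intros x y Hxy E; apply (Hn x y Hxy); rewrite (surjective_pairing (F x y)).
    unfold RtoC; f_equal; nra. }
  split; intros x y Hxy; specialize (Hs x y Hxy);
    destruct (F1 x y Hxy) as [A1 A2], (F2 x y Hxy) as [B1 B2]; unfold re, im in *; split.
  - refine (is_derive_eq _ _ _ _ _ (is_derive_over_norm _ _ _ _ _ _ _ A1 B1 A1 Hs)).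
    revert Hs; generalize (F x y) (F' x y); intros [p q] [p' q']; simpl; intros Hs.
    field; split; [intros Z; apply (Hsq p q Hs); rewrite <- Z; ring | nra].
  - refine (is_derive_eq _ _ _ _ _ (is_derive_over_norm _ _ _ _ _ _ _ A2 B2 A2 Hs)).
    revert Hs; generalize (F x y) (F' x y); intros [p q] [p' q']; simpl; intros Hs.
    field; split; [intros Z; apply (Hsq p q Hs); rewrite <- Z; ring | nra].
  - refine (is_derive_eq _ _ _ _ _
      (is_derive_over_norm _ _ _ _ _ _ _ A1 B1 (is_derive_opp_R _ _ _ B1) Hs)).
    revert Hs; generalize (F x y) (F' x y); intros [p q] [p' q']; simpl; intros Hs.
    field; split; [intros Z; apply (Hsq p q Hs); rewrite <- Z; ring | nra].
  - refine (is_derive_eq _ _ _ _ _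
      (is_derive_over_norm _ _ _ _ _ _ _ A2 B2 (is_derive_opp_R _ _ _ B2) Hs)).
    revert Hs; generalize (F x y) (F' x y); intros [p q] [p' q']; simpl; intros Hs.
    field; split; [intros Z; apply (Hsq p q Hs); rewrite <- Z; ring | nra].
Qed.

Lemma continuous_C_inv D F :
  (forall x y, D x y -> F x y <> RtoC 0) -> continuous_C D F ->
  continuous_C D (fun x y => / F x y)%C.
Proof.
  intros Hn [C1 C2].
  assert (C3 : continuous_on_2d D (fun x y => / (re F x y * re F x y + im F x y * im F x y))).
  { intros x y Hxy; apply continuity_2d_pt_inv.
    - apply continuity_2d_pt_plus; apply continuity_2d_pt_mult; auto.
    - intros E; apply (Hn x y Hxy); rewrite (surjective_pairing (F x y)).
      unfold RtoC, re, im in *; f_equal; nra. }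
  split; intros x y Hxy; unfold re, im.
  - apply (continuity_2d_pt_ext (fun x y => re F x y * / (re F x y * re F x y + im F x y * im F x y))).
    + intros a b; unfold re, im; simpl; rewrite !Rmult_1_r; reflexivity.
    + apply continuity_2d_pt_mult; auto.
  - apply (continuity_2d_pt_ext (fun x y => - im F x y * / (re F x y * re F x y + im F x y * im F x y))).
    + intros a b; unfold re, im; simpl; rewrite !Rmult_1_r; reflexivity.
    + apply continuity_2d_pt_mult; auto; apply continuity_2d_pt_opp; auto.
Qed.

(** By the Cauchy-Riemann equations the real differentials of the two components
    assemble into multiplication by F'; the errors of the components add up to at
    most sqrt 2 times the larger one, hence the precision eps / 2 for each. *)
Lemma has_cderiv_holomorphic D F F' x y :
  open_2d D -> has_cderiv D F F' -> continuous_C D F' -> D x y ->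
  @is_derive C_AbsRing C_NormedModule
    (fun z : C => (re F (fst z) (snd z), im F (fst z) (snd z)) : C) (x, y) (F' x y).
Proof.
  intros HD [H1 H2] [C1 C2] Hxy; split; [apply is_linear_scal_l|].
  intros z Hz.
  assert (Ez := is_filter_lim_locally_unique (V := AbsRing_NormedModule C_AbsRing) (x, y) z Hz).
  clear Hz; subst z; intros eps.
  apply (locally_C (x, y)).
  assert (He : 0 < eps / 2) by (destruct eps; simpl; lra).
  destruct (has_partials_differentiable D _ _ _ x y HD H1 C1 Hxy (mkposreal _ He)) as [d1 D1].
  destruct (has_partials_differentiable D _ _ _ x y HD H2 C2 Hxy (mkposreal _ He)) as [d2 D2].
  simpl in D1, D2.
  exists (mkposreal _ (Rmin_stable_in_posreal d1 d2)); intros [u v] [Hu Hv].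
  change (Rabs (u - x) < Rmin d1 d2) in Hu; change (Rabs (v - y) < Rmin d1 d2) in Hv.
  assert (L1 : Rabs (u - x) < d1) by (eapply Rlt_le_trans; [exact Hu | apply Rmin_l]).
  assert (L2 : Rabs (v - y) < d1) by (eapply Rlt_le_trans; [exact Hv | apply Rmin_l]).
  assert (L3 : Rabs (u - x) < d2) by (eapply Rlt_le_trans; [exact Hu | apply Rmin_r]).
  assert (L4 : Rabs (v - y) < d2) by (eapply Rlt_le_trans; [exact Hv | apply Rmin_r]).
  specialize (D1 u v L1 L2); specialize (D2 u v L3 L4).
  change (Cmod ((re F u v, im F u v) - (re F x y, im F x y) - ((u, v) - (x, y)) * F' x y)%C
          <= eps * Cmod ((u, v) - (x, y))%C).
  pose proof (Rmax_Cmod ((u, v) - (x, y))%C) as HM; simpl in HM.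
  set (M := Rmax (Rabs (u - x)) (Rabs (v - y))) in *.
  change (Rmax (Rabs (u + - x)) (Rabs (v + - y))) with M in HM.
  eapply Rle_trans; [apply Cmod_2Rmax|]; simpl.
  assert (B : Rmax
     (Rabs (re F u v + - re F x y + - ((u + - x) * fst (F' x y) - (v + - y) * snd (F' x y))))
     (Rabs (im F u v + - im F x y + - ((u + - x) * snd (F' x y) + (v + - y) * fst (F' x y))))
     <= eps / 2 * M).
  { unfold re, im in *; apply Rmax_lub.
    - eapply Rle_trans; [right; apply f_equal | exact D1]; ring.
    - eapply Rle_trans; [right; apply f_equal | exact D2]; ring. }
  assert (S2 : sqrt 2 <= 2).
  { rewrite <- (sqrt_square 2) at 2 by lra; apply sqrt_le_1; lra. }
  assert (M0 : 0 <= M).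
  { eapply Rle_trans; [apply Rabs_pos | apply Rmax_l]. }
  assert (e0 : 0 < eps) by apply cond_pos.
  apply Rle_trans with (2 * (eps / 2 * M)).
  - apply Rmult_le_compat; trivial.
    + apply sqrt_pos.
    + eapply Rle_trans; [apply Rabs_pos | apply Rmax_l].
  - nra.
Qed.

(** * Functions of class C^k *)

(** The derivatives are quantified existentially, rather than given by [Derive],
    so that sums, products and inverses only require their derivatives to be
    known on D. *)
Fixpoint C_k (D : R -> R -> Prop) (k : nat) (f : R -> R -> R) : Prop :=
  continuous_on_2d D f /\
  match k with
  | O => True
  | S k => exists fx fy, has_partials D f fx fy /\ C_k D k fx /\ C_k D k fy
  end.

Lemma C_k_continuous D k f : C_k D k f -> continuous_on_2d D f.
Proof. destruct k; intros H; apply H. Qed.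

Lemma ex_diff_n_C_k D k f :
  (forall x y, D x y -> ex_diff_n f k x y) -> C_k D k f.
Proof.
  revert f; induction k as [|k IH]; intros f H.
  - split; trivial; intros x y Hxy; apply (H x y Hxy).
  - split.
    + intros x y Hxy; apply (H x y Hxy).
    + exists (fun x y => Derive (fun z => f z y) x), (fun x y => Derive (fun z => f x z) y).
      split; [|split].
      * intros x y Hxy; destruct (H x y Hxy) as [_ [Hx [Hy _]]].
        split; apply Derive_correct; assumption.
      * apply IH; intros x y Hxy; apply (H x y Hxy).
      * apply IH; intros x y Hxy; apply (H x y Hxy).
Qed.

Lemma C_k_pred D k f : C_k D (S k) f -> C_k D k f.
Proof.
  revert f; induction k as [|k IH]; intros f [Hc [fx [fy [H [Hx Hy]]]]].
  - split; trivial.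
  - split; trivial; exists fx, fy; auto.
Qed.

Lemma C_k_plus D k f g : C_k D k f -> C_k D k g -> C_k D k (fun x y => f x y + g x y).
Proof.
  revert f g; induction k as [|k IH]; intros f g [Cf Hf] [Cg Hg];
    (split; [intros x y Hxy; apply continuity_2d_pt_plus; auto|]); trivial.
  destruct Hf as [fx [fy [Pf [Fx Fy]]]], Hg as [gx [gy [Pg [Gx Gy]]]].
  exists (fun x y => fx x y + gx x y), (fun x y => fy x y + gy x y); split; [|split]; auto.
  intros x y Hxy; destruct (Pf x y Hxy), (Pg x y Hxy); split; derive_arith.
Qed.

Lemma C_k_opp D k f : C_k D k f -> C_k D k (fun x y => - f x y).
Proof.
  revert f; induction k as [|k IH]; intros f [Cf Hf];
    (split; [intros x y Hxy; apply continuity_2d_pt_opp; auto|]); trivial.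
  destruct Hf as [fx [fy [Pf [Fx Fy]]]].
  exists (fun x y => - fx x y), (fun x y => - fy x y); split; [|split]; auto.
  intros x y Hxy; destruct (Pf x y Hxy); split; derive_arith.
Qed.

Lemma C_k_mult D k f g : C_k D k f -> C_k D k g -> C_k D k (fun x y => f x y * g x y).
Proof.
  revert f g; induction k as [|k IH]; intros f g Hf Hg.
  - destruct Hf as [Cf _], Hg as [Cg _]; split; trivial.
    intros x y Hxy; apply continuity_2d_pt_mult; auto.
  - pose proof (C_k_pred _ _ _ Hf) as Hf'; pose proof (C_k_pred _ _ _ Hg) as Hg'.
    destruct Hf as [Cf [fx [fy [Pf [Fx Fy]]]]], Hg as [Cg [gx [gy [Pg [Gx Gy]]]]].
    split; [intros x y Hxy; apply continuity_2d_pt_mult; auto|].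
    exists (fun x y => fx x y * g x y + f x y * gx x y),
           (fun x y => fy x y * g x y + f x y * gy x y).
    split; [|split; apply C_k_plus; auto].
    intros x y Hxy; destruct (Pf x y Hxy), (Pg x y Hxy); split; derive_arith.
Qed.

Lemma C_k_inv D k f : (forall x y, D x y -> f x y <> 0) -> C_k D k f -> C_k D k (fun x y => / f x y).
Proof.
  intros Hn; induction k as [|k IH]; intros Hf.
  - destruct Hf as [Cf _]; split; trivial.
    intros x y Hxy; apply continuity_2d_pt_inv; auto.
  - pose proof (IH (C_k_pred _ _ _ Hf)) as Hi.
    destruct Hf as [Cf [fx [fy [Pf [Fx Fy]]]]].
    split; [intros x y Hxy; apply continuity_2d_pt_inv; auto|].
    exists (fun x y => - fx x y * (/ f x y * / f x y)),
           (fun x y => - fy x y * (/ f x y * / f x y)).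
    split; [|split; apply C_k_mult; try apply C_k_opp; try apply C_k_mult; auto].
    intros x y Hxy; destruct (Pf x y Hxy) as [A B]; specialize (Hn x y Hxy).
    split; (eapply is_derive_eq; [|apply is_derive_inv; [eassumption | exact Hn]]);
      simpl; field; exact Hn.
Qed.

Lemma is_derive_ln_comp (f : R -> R) x df :
  is_derive f x df -> 0 < f x -> is_derive (fun t => ln (f t)) x (df * / f x).
Proof. intros Hf H; exact (is_derive_comp ln f x _ _ (is_derive_ln _ H) Hf). Qed.

Lemma C_k_ln D k f :
  (forall x y, D x y -> 0 < f x y) -> C_k D (S k) f -> C_k D (S k) (fun x y => ln (f x y)).
Proof.
  intros Hp Hf.
  assert (Hi : C_k D k (fun x y => / f x y)).
  { apply C_k_inv; [intros x y Hxy; specialize (Hp x y Hxy); lra | exact (C_k_pred _ _ _ Hf)]. }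
  destruct Hf as [Cf [fx [fy [Pf [Fx Fy]]]]]; split.
  - intros x y Hxy; apply (continuity_1d_2d_pt_comp ln f); auto.
    apply derivable_continuous_pt; exists (/ f x y).
    apply is_derive_Reals, is_derive_ln; auto.
  - exists (fun x y => fx x y * / f x y), (fun x y => fy x y * / f x y).
    split; [|split; apply C_k_mult; auto].
    intros x y Hxy; destruct (Pf x y Hxy); split;
      [apply (is_derive_ln_comp (fun s => f s y)) | apply (is_derive_ln_comp (fun t => f x t))]; auto.
Qed.

Lemma has_partials_unique D f g fx fy gx gy :
  open_2d D -> (forall x y, D x y -> f x y = g x y) ->
  has_partials D f fx fy -> has_partials D g gx gy ->
  forall x y, D x y -> fx x y = gx x y /\ fy x y = gy x y.
Proof.
  intros HD E Hf Hg x y Hxy; destruct (Hf x y Hxy) as [F1 F2], (Hg x y Hxy) as [G1 G2].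
  assert (L := HD x y Hxy); split.
  - rewrite <- (is_derive_unique _ _ _ F1), <- (is_derive_unique _ _ _ G1).
    apply Derive_ext_loc; apply locally_2d_1d_const_y in L; revert L.
    apply filter_imp; intros t Ht; apply E, Ht.
  - rewrite <- (is_derive_unique _ _ _ F2), <- (is_derive_unique _ _ _ G2).
    apply Derive_ext_loc; apply locally_2d_1d_const_x in L; revert L.
    apply filter_imp; intros t Ht; apply E, Ht.
Qed.

Lemma mixed_partials_eq D f fx fy fxx fxy fyx fyy :
  open_2d D -> has_partials D f fx fy ->
  has_partials D fx fxx fxy -> has_partials D fy fyx fyy ->
  continuous_on_2d D fxy -> continuous_on_2d D fyx ->
  forall x y, D x y -> fxy x y = fyx x y.
Proof.
  intros HD H Hx Hy Cxy Cyx.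
  assert (Ex : forall x y, D x y -> is_derive (fun t => Derive (fun s => f s t) x) y (fxy x y)).
  { intros x y Hxy; apply (is_derive_ext_loc (fun t => fx x t)); [|apply Hx, Hxy].
    assert (L := locally_2d_1d_const_x _ _ _ (HD x y Hxy)); revert L; apply filter_imp.
    intros t Ht; symmetry; apply is_derive_unique, H, Ht. }
  assert (Ey : forall x y, D x y -> is_derive (fun s => Derive (fun t => f s t) y) x (fyx x y)).
  { intros x y Hxy; apply (is_derive_ext_loc (fun s => fy s y)); [|apply Hy, Hxy].
    assert (L := locally_2d_1d_const_y _ _ _ (HD x y Hxy)); revert L; apply filter_imp.
    intros t Ht; symmetry; apply is_derive_unique, H, Ht. }
  intros x y Hxy.
  rewrite <- (is_derive_unique _ _ _ (Ex x y Hxy)), <- (is_derive_unique _ _ _ (Ey x y Hxy)).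
  symmetry; destruct (HD x y Hxy) as [d Hd]; apply (Schwarz f x y).
  - exists d; intros u v Hu Hv; specialize (Hd u v Hu Hv).
    split; [|split; [|split]].
    + exists (fx u v); apply H, Hd.
    + exists (fy u v); apply H, Hd.
    + exists (fyx u v); apply Ey, Hd.
    + exists (fxy u v); apply Ex, Hd.
  - apply (continuity_2d_pt_ext_loc fyx); [|apply Cyx, Hxy].
    exists d; intros u v Hu Hv; symmetry; apply is_derive_unique, Ey, Hd; assumption.
  - apply (continuity_2d_pt_ext_loc fxy); [|apply Cxy, Hxy].
    exists d; intros u v Hu Hv; symmetry; apply is_derive_unique, Ex, Hd; assumption.
Qed.

(** * The holomorphic potential of a solution *)

(** This is q = p_zz / 2 - p_z^2 / 4 in terms of the real derivatives of p, with
    p_z = (p_x - i p_y) / 2. *)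
Definition potential (px py pxx pxy pyy : R -> R -> R) (x y : R) : C :=
  (/ 8 * (pxx x y - pyy x y) - / 16 * (px x y * px x y - py x y * py x y),
   / 8 * (px x y * py x y) - / 4 * pxy x y).

(** The zbar-derivative of q is (p_{z zbar})_z / 2 - p_z p_{z zbar} / 2, which
    vanishes because p_{z zbar} is a multiple of exp p.  In real terms this
    is the equation differentiated once in x and once in y. *)
Lemma potential_holomorphic D p px py pxx pxy pyy :
  open_2d D ->
  has_partials D p px py -> has_partials D px pxx pxy -> has_partials D py pxy pyy ->
  C_k D 1 pxx -> C_k D 1 pxy -> C_k D 1 pyy ->
  (forall x y, D x y -> pxx x y + pyy x y = - 2 * exp (p x y)) ->
  exists q', has_cderiv D (potential px py pxx pxy pyy) q' /\ continuous_C D q'.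
Proof.
  intros HD Hp Hpx Hpy [Cxx [pxxx [pxxy [Hxx [[Cxxx _] [Cxxy _]]]]]]
    [Cxy [pxyx [pxyy [Hxy [[Cxyx _] [Cxyy _]]]]]]
    [Cyy [pyyx [pyyy [Hyy [[Cyyx _] [Cyyy _]]]]]] PDE.
  assert (Cx : continuous_on_2d D px) by exact (has_partials_continuous D _ _ _ HD Hpx Cxx).
  assert (Cy : continuous_on_2d D py) by exact (has_partials_continuous D _ _ _ HD Hpy Cxy).
  assert (S1 := mixed_partials_eq D px _ _ _ _ _ _ HD Hpx Hxx Hxy Cxxy Cxyx).
  assert (S2 := mixed_partials_eq D py _ _ _ _ _ _ HD Hpy Hxy Hyy Cxyy Cyyx).
  assert (P : forall x y, D x y ->
     pxxx x y + pyyx x y = - 2 * (px x y * exp (p x y)) /\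
     pxxy x y + pyyy x y = - 2 * (py x y * exp (p x y))).
  { apply (has_partials_unique D (fun x y => pxx x y + pyy x y) (fun x y => - 2 * exp (p x y))
             (fun x y => pxxx x y + pyyx x y) (fun x y => pxxy x y + pyyy x y)
             (fun x y => - 2 * (px x y * exp (p x y))) (fun x y => - 2 * (py x y * exp (p x y))));
      trivial.
    - intros x y H; destruct (Hxx x y H), (Hyy x y H); split; derive_arith.
    - intros x y H; destruct (Hp x y H); split; (eapply is_derive_eq; [|derive_arith]); simpl; ring. }
  exists (fun x y =>
    (/ 8 * (pxxx x y - pyyx x y) - / 8 * (px x y * pxx x y - py x y * pxy x y),
     / 8 * (pxx x y * py x y + px x y * pxy x y) - / 4 * pxyx x y)).
  split; split; unfold re, im; simpl; intros x y H.
  - destruct (Hpx x y H), (Hpy x y H), (Hxx x y H), (Hyy x y H), (P x y H) as [P1 P2].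
    specialize (S1 x y H); specialize (S2 x y H); specialize (PDE x y H).
    split; (eapply is_derive_eq; [|derive_arith]); simpl; [field|].
    rewrite <- S1.
    replace (pyyy x y) with (- 2 * (py x y * exp (p x y)) - pxxy x y) by lra.
    replace (pyy x y) with (- 2 * exp (p x y) - pxx x y) by lra; field.
  - destruct (Hpx x y H), (Hpy x y H), (Hxy x y H), (P x y H) as [P1 P2].
    specialize (S1 x y H); specialize (S2 x y H); specialize (PDE x y H).
    split; (eapply is_derive_eq; [|derive_arith]); simpl; [field|].
    rewrite S2.
    replace (pxxx x y) with (- 2 * (px x y * exp (p x y)) - pyyx x y) by lra.
    replace (pxx x y) with (- 2 * exp (p x y) - pyy x y) by lra; field.
  - repeat first [apply continuity_2d_pt_minus | apply continuity_2d_pt_mult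
                 | apply continuity_2d_pt_const]; auto.
  - repeat first [apply continuity_2d_pt_minus | apply continuity_2d_pt_plus
                 | apply continuity_2d_pt_mult | apply continuity_2d_pt_const]; auto.
Qed.

(** * Hermitian products of solutions *)

(** The real form of the system y_z = m - p_z y / 2, y_zbar = 0,
    m_z = p_z m / 2, m_zbar = - exp p y / 4 for y = y1 + i y2, m = m1 + i m2. *)
Definition is_frame (D : R -> R -> Prop) (p px py y1 y2 m1 m2 : R -> R -> R) : Prop :=
  has_partials D y1
    (fun x y => m1 x y - / 4 * (px x y * y1 x y + py x y * y2 x y))
    (fun x y => - (m2 x y - / 4 * (px x y * y2 x y - py x y * y1 x y))) /\
  has_partials D y2
    (fun x y => m2 x y - / 4 * (px x y * y2 x y - py x y * y1 x y))
    (fun x y => m1 x y - / 4 * (px x y * y1 x y + py x y * y2 x y)) /\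
  has_partials D m1
    (fun x y => / 4 * (px x y * m1 x y + py x y * m2 x y) - / 4 * (exp (p x y) * y1 x y))
    (fun x y => - (/ 4 * (px x y * m2 x y - py x y * m1 x y)) - / 4 * (exp (p x y) * y2 x y)) /\
  has_partials D m2
    (fun x y => / 4 * (px x y * m2 x y - py x y * m1 x y) - / 4 * (exp (p x y) * y2 x y))
    (fun x y => / 4 * (px x y * m1 x y + py x y * m2 x y) + / 4 * (exp (p x y) * y1 x y)).

(** The real and imaginary parts of m = y' + p_z y / 2, where E stands for y'. *)
Definition frame_re (px py : R -> R -> R) (Y E : R -> R -> C) (x y : R) : R :=
  re E x y + / 4 * (px x y * re Y x y + py x y * im Y x y).
Definition frame_im (px py : R -> R -> R) (Y E : R -> R -> C) (x y : R) : R :=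
  im E x y + / 4 * (px x y * im Y x y - py x y * re Y x y).

(** m_z = - q y + p_zz y / 2 + p_z y' / 2 = p_z m / 2 by the choice of q, and
    m_zbar = p_{z zbar} y / 2 = - exp p y / 4 by the equation for p. *)
Lemma solution_is_frame D p px py pxx pxy pyy Y E :
  has_partials D px pxx pxy -> has_partials D py pxy pyy ->
  (forall x y, D x y -> pxx x y + pyy x y = - 2 * exp (p x y)) ->
  has_cderiv D Y E ->
  has_cderiv D E (fun x y => - (potential px py pxx pxy pyy x y * Y x y))%C ->
  is_frame D p px py (re Y) (im Y) (frame_re px py Y E) (frame_im px py Y E).
Proof.
  intros Hpx Hpy PDE [Y1 Y2] [E1 E2].
  assert (S : forall x y, D x y -> pyy x y = - 2 * exp (p x y) - pxx x y).
  { intros x y H; specialize (PDE x y H); lra. }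
  unfold frame_re, frame_im; split; [|split; [|split]]; intros x y H;
    destruct (Hpx x y H), (Hpy x y H), (Y1 x y H), (Y2 x y H), (E1 x y H), (E2 x y H);
    specialize (S x y H).
  - split; (eapply is_derive_eq; [|derive_arith]); ring.
  - split; (eapply is_derive_eq; [|derive_arith]); ring.
  - split; (eapply is_derive_eq; [|derive_arith]); unfold re, im; simpl; rewrite S; field.
  - split; (eapply is_derive_eq; [|derive_arith]); unfold re, im; simpl; rewrite S; field.
Qed.

(** The real and imaginary parts of m conj n + exp p y conj z / 4. *)
Definition gram_re (p y1 y2 m1 m2 z1 z2 n1 n2 : R -> R -> R) (x y : R) : R :=
  m1 x y * n1 x y + m2 x y * n2 x y
    + / 4 * (exp (p x y) * (y1 x y * z1 x y + y2 x y * z2 x y)).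
Definition gram_im (p y1 y2 m1 m2 z1 z2 n1 n2 : R -> R -> R) (x y : R) : R :=
  m2 x y * n1 x y - m1 x y * n2 x y
    + / 4 * (exp (p x y) * (y2 x y * z1 x y - y1 x y * z2 x y)).

(** In the z-derivative of the product, the contribution of n_zbar to the first
    term cancels that of y_z = m - p_z y / 2 in m, and the remaining terms are
    p_z / 2 times the product; likewise for zbar. *)
Lemma gram_partials D p px py y1 y2 m1 m2 z1 z2 n1 n2 :
  has_partials D p px py ->
  is_frame D p px py y1 y2 m1 m2 -> is_frame D p px py z1 z2 n1 n2 ->
  has_partials D (gram_re p y1 y2 m1 m2 z1 z2 n1 n2)
    (fun x y => / 2 * (px x y * gram_re p y1 y2 m1 m2 z1 z2 n1 n2 x y))
    (fun x y => / 2 * (py x y * gram_re p y1 y2 m1 m2 z1 z2 n1 n2 x y)) /\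
  has_partials D (gram_im p y1 y2 m1 m2 z1 z2 n1 n2)
    (fun x y => / 2 * (px x y * gram_im p y1 y2 m1 m2 z1 z2 n1 n2 x y))
    (fun x y => / 2 * (py x y * gram_im p y1 y2 m1 m2 z1 z2 n1 n2 x y)).
Proof.
  intros Hp [A1 [A2 [A3 A4]]] [B1 [B2 [B3 B4]]]; unfold gram_re, gram_im.
  split; intros x y H;
    destruct (Hp x y H), (A1 x y H), (A2 x y H), (A3 x y H), (A4 x y H),
      (B1 x y H), (B2 x y H), (B3 x y H), (B4 x y H);
    split; (eapply is_derive_eq; [|derive_arith]); simpl; field.
Qed.

Lemma constant_in_ball (f : R -> R) a b r :
  (forall s, Rabs (s - a) < r -> is_derive f s 0) -> Rabs (b - a) < r -> f b = f a.
Proof.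
  intros Hf Hb; destruct (Rtotal_order a b) as [L|[E|L]]; [symmetry| now rewrite E |];
    apply (eq_is_derive f); trivial; intros t Ht; apply Hf;
    revert Hb Ht; unfold Rabs; repeat destruct Rcase_abs; lra.
Qed.

(** The function k exp (- p / 2) has vanishing partial derivatives, hence is
    constant on the box. *)
Lemma linear_partials_vanish x0 y0 r p px py k :
  has_partials (box x0 y0 r) p px py ->
  has_partials (box x0 y0 r) k (fun x y => / 2 * (px x y * k x y))
    (fun x y => / 2 * (py x y * k x y)) ->
  k x0 y0 = 0 -> forall x y, box x0 y0 r x y -> k x y = 0.
Proof.
  intros Hp Hk H0 x y Hxy.
  assert (B0 := center_in_box _ _ _ _ _ Hxy); destruct Hxy as [Hx Hy], B0 as [H0x H0y].
  set (l := fun x y => k x y * exp (- (/ 2 * p x y))).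
  assert (Hl : forall x y, box x0 y0 r x y ->
     is_derive (fun s => l s y) x 0 /\ is_derive (fun t => l x t) y 0).
  { intros a b H; destruct (Hp a b H), (Hk a b H); unfold l.
    split; (eapply is_derive_eq; [|derive_arith]); simpl; field. }
  assert (L : l x y = 0).
  { rewrite (constant_in_ball (fun t => l x t) y0 y r); trivial.
    - rewrite (constant_in_ball (fun s => l s y0) x0 x r); trivial.
      + unfold l; rewrite H0; ring.
      + intros s Hs; exact (proj1 (Hl s y0 (conj Hs H0y))).
    - intros t Ht; exact (proj2 (Hl x t (conj Hx Ht))). }
  unfold l in L; apply Rmult_integral in L; destruct L as [L|L]; trivial.
  pose proof (exp_pos (- (/ 2 * p x y))); lra.
Qed.

Definition normsq (z : C) : R := fst z * fst z + snd z * snd z.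

Lemma normsq_mult z w : normsq (z * w)%C = normsq z * normsq w.
Proof. unfold normsq; simpl; ring. Qed.

Lemma normsq_inv z : z <> RtoC 0 -> normsq (/ z)%C = / normsq z.
Proof.
  intros Hz; assert (H : normsq z * normsq (/ z)%C = 1).
  { rewrite <- normsq_mult, Cinv_r by exact Hz; unfold normsq; simpl; ring. }
  assert (N : normsq z <> 0) by (intros E; rewrite E in H; lra).
  apply (Rmult_eq_reg_l (normsq z)); trivial; rewrite H; field; exact N.
Qed.

Lemma normsq_pos z : z <> RtoC 0 -> 0 < normsq z.
Proof.
  intros Hz; unfold normsq.
  destruct (Req_dec (fst z) 0) as [E|E]; [|nra].
  destruct (Req_dec (snd z) 0) as [E'|E']; [|nra].
  exfalso; apply Hz; rewrite (surjective_pairing z), E, E'; reflexivity.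
Qed.

(** The three conditions say that (m, sqrt nu y / 2) and (n, sqrt nu z / 2) are
    orthogonal of the same squared length h.  With d = |n y - m z|^2, the Gram
    determinant is h^2 = nu d / 4, while expanding d directly gives
    d = (|y|^2 + |z|^2) h; eliminating h yields the claim. *)
Lemma unitary_rows nu (y m z n : C) :
  0 < nu -> y <> RtoC 0 ->
  normsq m + / 4 * (nu * normsq y) = normsq n + / 4 * (nu * normsq z) ->
  fst m * fst n + snd m * snd n + / 4 * (nu * (fst y * fst z + snd y * snd z)) = 0 ->
  snd m * fst n - fst m * snd n + / 4 * (nu * (snd y * fst z - fst y * snd z)) = 0 ->
  nu * (normsq y + normsq z) ^ 2 = 4 * normsq (n * y - m * z)%C.
Proof.
  intros Hnu Hy E1 E2 E3; apply normsq_pos in Hy.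
  destruct y as [y1 y2], m as [m1 m2], z as [z1 z2], n as [n1 n2].
  unfold normsq in *; simpl in *.
  set (d := (n1 * y1 - n2 * y2 + - (m1 * z1 - m2 * z2)) *
            (n1 * y1 - n2 * y2 + - (m1 * z1 - m2 * z2)) +
            (n1 * y2 + n2 * y1 + - (m1 * z2 + m2 * z1)) *
            (n1 * y2 + n2 * y1 + - (m1 * z2 + m2 * z1))).
  set (h := m1 * m1 + m2 * m2 + / 4 * (nu * (y1 * y1 + y2 * y2))) in *.
  set (h' := n1 * n1 + n2 * n2 + / 4 * (nu * (z1 * z1 + z2 * z2))) in *.
  set (a := m1 * n1 + m2 * n2 + / 4 * (nu * (y1 * z1 + y2 * z2))) in *.
  set (b := m2 * n1 - m1 * n2 + / 4 * (nu * (y2 * z1 - y1 * z2))) in *.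
  assert (I1 : d = (z1 * z1 + z2 * z2) * h + (y1 * y1 + y2 * y2) * h'
                   - 2 * (a * (y1 * z1 + y2 * z2) + b * (y2 * z1 - y1 * z2))).
  { unfold d, h, h', a, b; ring. }
  assert (I2 : h * h' - a * a - b * b = / 4 * nu * d).
  { unfold d, h, h', a, b; ring. }
  rewrite E2, E3 in I1, I2; rewrite <- E1 in I1, I2.
  assert (hpos : 0 < h).
  { unfold h; clear - Hnu Hy; nra. }
  assert (N : d = (y1 * y1 + y2 * y2 + (z1 * z1 + z2 * z2)) * h) by (rewrite I1; ring).
  set (s := y1 * y1 + y2 * y2 + (z1 * z1 + z2 * z2)) in *.
  assert (J : h = / 4 * nu * s).
  { apply (Rmult_eq_reg_r h); [|lra].
    replace (h * h) with (h * h - 0 * 0 - 0 * 0) by ring.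
    rewrite I2, N; ring. }
  rewrite N, J; field.
Qed.

(** * The local representation *)

Lemma laplacian_partials D f fx fy fxx fxy fyx fyy x y :
  open_2d D -> has_partials D f fx fy ->
  has_partials D fx fxx fxy -> has_partials D fy fyx fyy -> D x y ->
  laplacian f x y = fxx x y + fyy x y.
Proof.
  intros HD H Hx Hy Hxy.
  assert (Lx := locally_2d_1d_const_y _ _ _ (HD x y Hxy)).
  assert (Ly := locally_2d_1d_const_x _ _ _ (HD x y Hxy)).
  change (Derive (fun s => Derive (fun s => f s y) s) x +
          Derive (fun t => Derive (fun t => f x t) t) y = fxx x y + fyy x y).
  f_equal; apply is_derive_unique.
  - apply (is_derive_ext_loc (fun s => fx s y)); [|apply Hx, Hxy].
    revert Lx; apply filter_imp; intros s Hs; symmetry; apply is_derive_unique, H, Hs.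
  - apply (is_derive_ext_loc (fun t => fy x t)); [|apply Hy, Hxy].
    revert Ly; apply filter_imp; intros t Ht; symmetry; apply is_derive_unique, H, Ht.
Qed.

Lemma has_partials_box_smaller x0 y0 r r' f fx fy :
  r' <= r -> has_partials (box x0 y0 r) f fx fy -> has_partials (box x0 y0 r') f fx fy.
Proof. intros Hr H x y [Hx Hy]; apply H; split; lra. Qed.

Lemma has_cderiv_box_smaller x0 y0 r r' F F' :
  r' <= r -> has_cderiv (box x0 y0 r) F F' -> has_cderiv (box x0 y0 r') F F'.
Proof. intros Hr [H1 H2]; split; eapply has_partials_box_smaller; eassumption. Qed.

Lemma continuous_C_box_smaller x0 y0 r r' F :
  r' <= r -> continuous_C (box x0 y0 r) F -> continuous_C (box x0 y0 r') F.
Proof. intros Hr [H1 H2]; split; intros x y [Hx Hy]; [apply H1 | apply H2]; split; lra. Qed.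

(** Near the centre the continuous function q is bounded by its value there
    plus 1, and on a small enough box this bound makes Picard iteration converge
    for all initial values at once. *)
Lemma complex_linear_ode_local x0 y0 r0 q q' :
  0 < r0 -> has_cderiv (box x0 y0 r0) q q' -> continuous_C (box x0 y0 r0) q' ->
  exists r, 0 < r <= r0 /\ forall a b : C,
    exists Y E : R -> R -> C,
      has_cderiv (box x0 y0 r) Y E /\
      has_cderiv (box x0 y0 r) E (fun x y => - (q x y * Y x y))%C /\
      continuous_C (box x0 y0 r) Y /\ continuous_C (box x0 y0 r) E /\
      Y x0 y0 = a /\ E x0 y0 = b.
Proof.
  intros H0 Hq Cq'.
  assert (Cq := has_cderiv_continuous _ _ _ (box_open x0 y0 r0) Hq Cq').
  assert (B0 : box x0 y0 r0 x0 y0) by (split; rewrite Rminus_diag, Rabs_R0; exact H0).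
  destruct (proj1 Cq x0 y0 B0 (mkposreal 1 Rlt_0_1)) as [d1 Hd1].
  destruct (proj2 Cq x0 y0 B0 (mkposreal 1 Rlt_0_1)) as [d2 Hd2].
  simpl in Hd1, Hd2.
  set (Q := Rabs (re q x0 y0) + Rabs (im q x0 y0) + 1).
  assert (Q1 : 1 <= Q).
  { unfold Q; pose proof (Rabs_pos (re q x0 y0)); pose proof (Rabs_pos (im q x0 y0)); lra. }
  set (r := Rmin (Rmin r0 (Rmin d1 d2)) (Rmin (1 / 4) (/ (8 * Q)))).
  assert (r_pos : 0 < r).
  { unfold r; repeat apply Rmin_pos; try apply cond_pos; try lra.
    apply Rinv_0_lt_compat; lra. }
  assert (r_le : r <= r0 /\ r <= d1 /\ r <= d2 /\ r <= 1 / 4 /\ r <= / (8 * Q)).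
  { unfold r; repeat split;
      repeat first [apply Rle_refl | eapply Rle_trans; [apply Rmin_l|]; apply Rle_refl
        | eapply Rle_trans; [apply Rmin_r|]; apply Rle_refl ].
    - eapply Rle_trans; [apply Rmin_l | apply Rmin_l].
    - eapply Rle_trans; [apply Rmin_l | eapply Rle_trans; [apply Rmin_r | apply Rmin_l]].
    - eapply Rle_trans; [apply Rmin_l | eapply Rle_trans; [apply Rmin_r | apply Rmin_r]].
    - eapply Rle_trans; [apply Rmin_r | apply Rmin_l].
    - eapply Rle_trans; [apply Rmin_r | apply Rmin_r]. }
  clearbody r; destruct r_le as [rr0 [rd1 [rd2 [r4 rQ]]]].
  assert (rQ' : r * Q <= 1 / 8).
  { apply Rle_trans with (/ (8 * Q) * Q); [apply Rmult_le_compat_r; lra|].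
    right; field; lra. }
  assert (HQ : forall x y, box x0 y0 r x y -> Rabs (re q x y) <= Q /\ Rabs (im q x y) <= Q).
  { intros x y [Hx Hy].
    assert (A1 := Hd1 x y (Rlt_le_trans _ _ _ Hx rd1) (Rlt_le_trans _ _ _ Hy rd1)).
    assert (A2 := Hd2 x y (Rlt_le_trans _ _ _ Hx rd2) (Rlt_le_trans _ _ _ Hy rd2)).
    pose proof (Rabs_pos (re q x0 y0)); pose proof (Rabs_pos (im q x0 y0)).
    pose proof (Rabs_triang_inv (re q x y) (re q x0 y0)).
    pose proof (Rabs_triang_inv (im q x y) (im q x0 y0)).
    unfold Q; split; lra. }
  assert (HqB := has_cderiv_box_smaller _ _ _ _ _ _ rr0 Hq).
  assert (CqB := continuous_C_box_smaller _ _ _ _ _ rr0 Cq').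
  exists r; split; [split; assumption|]; intros a b.
  destruct (complex_linear_ode x0 y0 r q q' Q a b) as [Y [E [HY [HE [CY [Y0 E0]]]]]]; trivial.
  exists Y, E; repeat (split; [assumption|]); split; [|split; assumption].
  apply (has_cderiv_continuous _ _ _ (box_open _ _ _) HE).
  apply continuous_C_opp, continuous_C_mult; [|exact CY].
  exact (has_cderiv_continuous _ _ _ (box_open _ _ _) HqB CqB).
Qed.

Lemma liouville_local x0 y0 r0 p px py pxx pxy pyy :
  0 < r0 ->
  has_partials (box x0 y0 r0) p px py ->
  has_partials (box x0 y0 r0) px pxx pxy -> has_partials (box x0 y0 r0) py pxy pyy ->
  C_k (box x0 y0 r0) 1 pxx -> C_k (box x0 y0 r0) 1 pxy -> C_k (box x0 y0 r0) 1 pyy ->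
  (forall x y, box x0 y0 r0 x y -> pxx x y + pyy x y = - 2 * exp (p x y)) ->
  exists r W W', 0 < r <= r0 /\
    has_cderiv (box x0 y0 r) W W' /\ continuous_C (box x0 y0 r) W' /\
    forall x y, box x0 y0 r x y ->
      exp (p x y) = 4 * normsq (W' x y) / (normsq (W x y) + 1) ^ 2.
Proof.
  intros H0 Hp Hpx Hpy Cxx Cxy Cyy PDE.
  destruct (potential_holomorphic _ p px py pxx pxy pyy (box_open x0 y0 r0)) as [q' [Hq Cq']];
    trivial.
  set (q := potential px py pxx pxy pyy) in *.
  assert (B0 : forall r, 0 < r -> box x0 y0 r x0 y0).
  { intros r Hr; split; rewrite Rminus_diag, Rabs_R0; exact Hr. }
  destruct (complex_linear_ode_local x0 y0 r0 q q' H0 Hq Cq') as [r [[r_pos rr0] Solve]].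
  set (B := box x0 y0 r) in *.
  assert (HpB := has_partials_box_smaller _ _ _ _ _ _ _ rr0 Hp).
  assert (HpxB := has_partials_box_smaller _ _ _ _ _ _ _ rr0 Hpx).
  assert (HpyB := has_partials_box_smaller _ _ _ _ _ _ _ rr0 Hpy).
  fold B in HpB, HpxB, HpyB.
  assert (PDEB : forall x y, B x y -> pxx x y + pyy x y = - 2 * exp (p x y)).
  { intros x y [Hx Hy]; apply PDE; split; lra. }
  (* Initial vectors (0, sqrt nu / 2) for Y and (sqrt nu / 2, 0) for Z, i.e.
     Y = 1 with companion 0, and Z = 0 with companion sqrt nu / 2. *)
  destruct (Solve (RtoC 1) (- / 4 * px x0 y0, / 4 * py x0 y0))
    as [Y [E [HY [HE [CY [CE [Y0 E0]]]]]]].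
  destruct (Solve (RtoC 0) (/ 2 * sqrt (exp (p x0 y0)), 0))
    as [Z [F [HZ [HF [CZ [CF [Z0 F0]]]]]]].
  fold B in HY, HE, CY, CE, HZ, HF, CZ, CF.
  assert (FY := solution_is_frame _ _ _ _ _ _ _ _ _ HpxB HpyB PDEB HY HE).
  assert (FZ := solution_is_frame _ _ _ _ _ _ _ _ _ HpxB HpyB PDEB HZ HF).
  assert (y1 : re Y x0 y0 = 1) by (unfold re; now rewrite Y0).
  assert (y2 : im Y x0 y0 = 0) by (unfold im; now rewrite Y0).
  assert (z1 : re Z x0 y0 = 0) by (unfold re; now rewrite Z0).
  assert (z2 : im Z x0 y0 = 0) by (unfold im; now rewrite Z0).
  assert (m1 : frame_re px py Y E x0 y0 = 0).
  { unfold frame_re; rewrite y1, y2; unfold re; rewrite E0; simpl; ring. }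
  assert (m2 : frame_im px py Y E x0 y0 = 0).
  { unfold frame_im; rewrite y1, y2; unfold im; rewrite E0; simpl; ring. }
  assert (n1 : frame_re px py Z F x0 y0 = / 2 * sqrt (exp (p x0 y0))).
  { unfold frame_re; rewrite z1, z2; unfold re; rewrite F0; simpl; ring. }
  assert (n2 : frame_im px py Z F x0 y0 = 0).
  { unfold frame_im; rewrite z1, z2; unfold im; rewrite F0; simpl; ring. }
  assert (Sq : sqrt (exp (p x0 y0)) * sqrt (exp (p x0 y0)) = exp (p x0 y0)).
  { apply sqrt_sqrt, Rlt_le, exp_pos. }
  destruct (gram_partials _ _ _ _ _ _ _ _ _ _ _ _ HpB FY FZ) as [G1 G2].
  destruct (gram_partials _ _ _ _ _ _ _ _ _ _ _ _ HpB FY FY) as [G3 _].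
  destruct (gram_partials _ _ _ _ _ _ _ _ _ _ _ _ HpB FZ FZ) as [G4 _].
  assert (V1 := linear_partials_vanish _ _ _ _ _ _ _ HpB G1).
  assert (V2 := linear_partials_vanish _ _ _ _ _ _ _ HpB G2).
  set (GY := gram_re p (re Y) (im Y) (frame_re px py Y E) (frame_im px py Y E)
                     (re Y) (im Y) (frame_re px py Y E) (frame_im px py Y E)) in *.
  set (GZ := gram_re p (re Z) (im Z) (frame_re px py Z F) (frame_im px py Z F)
                     (re Z) (im Z) (frame_re px py Z F) (frame_im px py Z F)) in *.
  assert (V3 : forall x y, B x y -> GY x y - GZ x y = 0).
  { apply (linear_partials_vanish x0 y0 r p px py (fun x y => GY x y - GZ x y)); trivial.
    - intros x y H; destruct (G3 x y H), (G4 x y H); split;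
        (eapply is_derive_eq; [|derive_arith]); simpl; ring.
    - unfold GY, GZ, gram_re; rewrite y1, y2, z1, z2, m1, m2, n1, n2.
      replace (/ 2 * sqrt (exp (p x0 y0)) * (/ 2 * sqrt (exp (p x0 y0))))
        with (/ 4 * (sqrt (exp (p x0 y0)) * sqrt (exp (p x0 y0)))) by field.
      rewrite Sq; ring. }
  specialize (V1 ltac:(unfold gram_re; rewrite y1, y2, z1, z2, m1, m2; ring)).
  specialize (V2 ltac:(unfold gram_im; rewrite y1, y2, z1, z2, m1, m2; ring)).
  (* On a smaller box Y does not vanish, so that w = Z / Y is defined. *)
  destruct (proj1 CY x0 y0 (B0 r r_pos) (mkposreal 1 Rlt_0_1)) as [d Hd]; simpl in Hd.
  set (s := Rmin r d).
  assert (s_pos : 0 < s) by (apply Rmin_pos; [exact r_pos | apply cond_pos]).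
  assert (sr : s <= r) by apply Rmin_l.
  assert (sd : s <= d) by apply Rmin_r.
  assert (sB : forall x y, box x0 y0 s x y -> B x y).
  { intros x y [Hx Hy]; split; lra. }
  assert (Yn : forall x y, box x0 y0 s x y -> Y x y <> RtoC 0).
  { intros x y [Hx Hy] Eq.
    assert (A := Hd x y (Rlt_le_trans _ _ _ Hx sd) (Rlt_le_trans _ _ _ Hy sd)).
    rewrite y1 in A; unfold re in A; rewrite Eq in A; simpl in A.
    apply Rabs_def2 in A; lra. }
  assert (HYs := has_cderiv_box_smaller _ _ _ _ _ _ sr HY).
  assert (HZs := has_cderiv_box_smaller _ _ _ _ _ _ sr HZ).
  assert (CYs := continuous_C_box_smaller _ _ _ _ _ sr CY).
  assert (CZs := continuous_C_box_smaller _ _ _ _ _ sr CZ).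
  assert (CEs := continuous_C_box_smaller _ _ _ _ _ sr CE).
  assert (CFs := continuous_C_box_smaller _ _ _ _ _ sr CF).
  assert (YYn : forall x y, box x0 y0 s x y -> (Y x y * Y x y)%C <> RtoC 0).
  { intros x y H; apply Cmult_neq_0; apply Yn, H. }
  eexists s, _, _; split; [split; lra|]; split; [|split].
  - exact (has_cderiv_mult _ _ _ _ _ HZs (has_cderiv_inv _ _ _ Yn HYs)).
  - apply continuous_C_plus; apply continuous_C_mult; trivial.
    + apply continuous_C_inv; trivial.
    + apply continuous_C_opp, continuous_C_mult; trivial.
      apply continuous_C_inv; trivial; apply continuous_C_mult; trivial.
  - intros x y H; cbv beta; specialize (Yn x y H); specialize (YYn x y H).
    assert (U := unitary_rows (exp (p x y)) (Y x y)
      (frame_re px py Y E x y, frame_im px py Y E x y) (Z x y)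
      (frame_re px py Z F x y, frame_im px py Z F x y) (exp_pos _) Yn).
    specialize (V1 x y (sB x y H)); specialize (V2 x y (sB x y H)); specialize (V3 x y (sB x y H)).
    specialize (U ltac:(apply Rminus_diag_uniq; exact V3) V1 V2).
    (* The p_z-terms of the companions cancel in this determinant. *)
    assert (Wr : ((frame_re px py Z F x y, frame_im px py Z F x y) * Y x y -
                  (frame_re px py Y E x y, frame_im px py Y E x y) * Z x y)%C
                 = (F x y * Y x y - E x y * Z x y)%C).
    { unfold frame_re, frame_im, re, im.
      generalize (Y x y) (Z x y) (E x y) (F x y); intros [? ?] [? ?] [? ?] [? ?].
      apply injective_projections; simpl; ring. }
    rewrite Wr in U; clear Wr.
    assert (Ny := normsq_pos _ Yn).
    assert (Dv : (F x y * / Y x y + Z x y * - (E x y * / (Y x y * Y x y)))%C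
                 = ((F x y * Y x y - E x y * Z x y) * / (Y x y * Y x y))%C) by (field; exact Yn).
    rewrite Dv, !normsq_mult, !normsq_inv, normsq_mult by assumption.
    assert (Nz : 0 <= normsq (Z x y)) by (unfold normsq; nra).
    replace (normsq (F x y * Y x y - E x y * Z x y)%C)
      with (exp (p x y) * (normsq (Y x y) + normsq (Z x y)) ^ 2 / 4) by (rewrite U; field).
    field; split; lra.
Qed.

Theorem corollary3p2 :
  forall (D : C -> Prop) (nu : R -> R -> R),
    open D ->
    smooth_on D nu ->
    (forall x y : R, D (x, y) ->
       laplacian (fun s t => ln (nu s t)) x y + 2 * nu x y = 0) ->
    (forall x y : R, D (x, y) -> 0 < nu x y) ->
    (forall x y : R, D (x, y) -> d_x nu x y * d_y nu x y <> 0) ->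
    forall p : C, D p ->
      exists (U : C -> Prop) (u v : R -> R -> R),
        open U /\ U p /\ (forall z : C, U z -> D z) /\
        holomorphic_on U (fun z => (u (fst z) (snd z), v (fst z) (snd z))) /\
        forall x y : R, U (x, y) ->
          nu x y =
            4 * ((d_x u x y) ^ 2 + (d_y u x y) ^ 2) /
            ((u x y) ^ 2 + (v x y) ^ 2 + 1) ^ 2.
Proof.
  intros D nu HD Hnu PDE Hpos _ [x0 y0] Hp0.
  destruct (proj2 (locally_2d_locally (fun x y => D (x, y)) x0 y0)) as [r0 Hr0].
  { refine (filter_imp _ _ _ (HD _ Hp0)); intros [a b]; trivial. }
  assert (sub : forall x y, box x0 y0 r0 x y -> D (x, y)).
  { intros x y [Hx Hy]; apply Hr0; assumption. }
  assert (HB := box_open x0 y0 r0).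
  assert (Hln : C_k (box x0 y0 r0) 3 (fun x y => ln (nu x y))).
  { apply C_k_ln; [intros x y H; apply Hpos, sub, H|].
    apply ex_diff_n_C_k; intros x y H; apply (Hnu x y (sub x y H)). }
  destruct Hln as [_ [px [py [Hp [[_ [pxx [pxy [Hpx [Cxx Cxy]]]]] [_ [pyx [pyy [Hpy [Cyx Cyy]]]]]]]]]].
  assert (S := mixed_partials_eq _ _ _ _ _ _ _ _ HB Hp Hpx Hpy
                 (C_k_continuous _ _ _ Cxy) (C_k_continuous _ _ _ Cyx)).
  assert (Hpy' : has_partials (box x0 y0 r0) py pxy pyy).
  { intros x y H; rewrite (S x y H); exact (Hpy x y H). }
  destruct (liouville_local x0 y0 r0 (fun x y => ln (nu x y)) px py pxx pxy pyy (cond_pos r0))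
    as [r [W [W' [[r_pos rr0] [HW [CW Hform]]]]]]; trivial.
  { intros x y H; rewrite <- (laplacian_partials _ _ _ _ _ _ _ _ _ _ HB Hp Hpx Hpy H).
    rewrite exp_ln by (apply Hpos, sub, H).
    specialize (PDE x y (sub x y H)); lra. }
  exists (fun z => box x0 y0 r (fst z) (snd z)), (re W), (im W).
  split; [|split; [|split; [|split]]].
  - intros [x y] H; apply (locally_2d_locally (box x0 y0 r) x y), box_open, H.
  - split; simpl; rewrite Rminus_diag, Rabs_R0; exact r_pos.
  - intros [x y] [Hx Hy]; apply sub; simpl in *; split; lra.
  - intros [x y] H; exists (W' x y).
    exact (has_cderiv_holomorphic _ _ _ _ _ (box_open x0 y0 r) HW CW H).
  - intros x y H; simpl in H.
    assert (Ex : d_x (re W) x y = re W' x y) by (apply is_derive_unique, HW, H).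
    assert (Ey : d_y (re W) x y = - im W' x y) by (apply is_derive_unique, HW, H).
    rewrite Ex, Ey; specialize (Hform x y H).
    rewrite exp_ln in Hform by (apply Hpos, sub; destruct H; split; lra).
    rewrite Hform; unfold normsq, re, im.
    f_equal; [|f_equal; f_equal; f_equal]; ring.
Qed.
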